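(* Let $R_0>0$, let $u_0\in L^1(0,\infty)$ be supported in $[0,R_0]$, and let $M=\int_0^\infty u_0(x)\,dx$. For $L\ge R_0$ let $u^L$ be the Hopf--Cole solution of the viscous Burgers problem on $(0,L)$ with conservative boundary conditions and datum $u_0$, and let $v^L(\xi,t)=\sqrt t\,u^L(\xi\sqrt t,t)$ for $0\le\xi\le L/\sqrt t$. Fix $c>0$, an integer $k\ge0$ and $R\in(0,c^{-1/2})$. Then there is a constant $C=C(\|u_0\|_{L^1},R_0,R,k,c)$ such that, for all $L\ge R_0$, $$\|v^L(\cdot,cL^2)-\Phi_c\|_{C^k([0,R])}\le\frac CL,$$ where $\Phi_c$ is the explicit profile defined in the context. In particular $v^L(\cdot,cL^2)\to\Phi_c$ in $C^k_{\rm loc}([0,c^{-1/2}))$ as $L\to\infty$, for every fixed $c>0$.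
   Context: Set $w_0(x)=\exp\left(\int_0^x u_0(z)\,dz\right)$. The interval problem is $u_t-u_{xx}=(u^2)_x$ in $(0,L)\times(0,\infty)$, $u_x=-u^2$ at $x=0$ and at $x=L$, $u(\cdot,0)=u_0$. Its Hopf--Cole solution is $u^L=w^L_x/w^L$, where $w^L>0$ is the classical solution (continuous up to $t=0$) of $w_t=w_{xx}$ in $(0,L)\times(0,\infty)$, $w(0,t)=1$, $w(L,t)=e^M$, $w(\cdot,0)=w_0$. The function $\varphi$ is the solution of $\varphi_\tau=\varphi_{yy}$ on $(0,1)\times(0,\infty)$, $\varphi(0,\tau)=0$, $\varphi(1,\tau)=1$, $\varphi(y,0)=1$; explicitly $$\varphi(y,\tau)=y+\frac2\pi\sum_{n\ge1}\frac{\sin(n\pi y)}{n}e^{-n^2\pi^2\tau},\qquad \tau>0.$$ For $c>0$ and $0\le\xi\le c^{-1/2}$, $$\Phi_c(\xi)=\sqrt c\,\frac{(e^M-1)\,\varphi_y(\xi\sqrt c,c)}{1+(e^M-1)\,\varphi(\xi\sqrt c,c)}.$$ *)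

(* Defs.v *)
From HB Require Import structures.
From mathcomp Require Export all_boot all_order all_algebra.
From mathcomp Require Export all_classical all_reals all_analysis.

Set Implicit Arguments.
Unset Strict Implicit.
Unset Printing Implicit Defensive.

Export Order.TTheory GRing.Theory Num.Theory.
Export numFieldNormedType.Exports.

Local Open Scope classical_set_scope.
Local Open Scope ring_scope.

(* Derivative relative to a set A: the difference quotients are taken along
   points of A only.  On `[a, b] it is the usual derivative at interior points
   and the one-sided derivative at a and b. *)
Definition diffq {R : realType} (f : R -> R) (x y : R) : R :=
  (f y - f x) / (y - x).

Definition derivable_in {R : realType} (A : set R) (f : R -> R) (x : R) : Prop :=
  cvg (diffq f x @ within A x^').

Definition derive_in {R : realType} (A : set R) (f : R -> R) : R -> R :=
  fun x => lim (diffq f x @ within A x^').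

Definition derive_in_n {R : realType} (A : set R) (j : nat) (f : R -> R) :
    R -> R :=
  iter j (derive_in A) f.

Definition is_Ck {R : realType} (A : set R) (k : nat) (f : R -> R) : Prop :=
  (forall j x, (j < k)%N -> A x -> derivable_in A (derive_in_n A j f) x) /\
  (forall j, (j <= k)%N -> {within A, continuous (derive_in_n A j f)}).

(* Extended-real valued, so that an unbounded derivative has norm +oo. *)
Definition Ck_norm {R : realType} (A : set R) (k : nat) (f : R -> R) : \bar R :=
  (\sum_(j < k.+1) ereal_sup [set `|derive_in_n A j f x|%:E | x in A])%E.

(* F L --> f in C^k_loc([0, b[) as L --> +oo; every compact subset of [0, b[
   lies in some [0, r] with 0 < r < b. *)
Definition Ck_loc_cvg {R : realType} (b : R) (k : nat) (F : R -> R -> R)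
    (f : R -> R) : Prop :=
  forall r : R, 0 < r -> r < b ->
    Ck_norm `[0, r] k (F L \- f) @[L --> +oo] --> 0%E.

(* u0 represents an element of L^1(0, oo) with (essential) support in [0, R0];
   its values on ]-oo, 0] are never used. *)
Definition L1_supported {R : realType} (R0 : R) (u0 : R -> R) : Prop :=
  (@lebesgue_measure R).-integrable `]0, +oo[ (EFin \o u0) /\
  {ae @lebesgue_measure R, forall x, R0 < x -> u0 x = 0}.

Definition L1_norm {R : realType} (u0 : R -> R) : R :=
  \int[@lebesgue_measure R]_(x in `]0, +oo[) `|u0 x|.

Definition mass {R : realType} (u0 : R -> R) : R :=
  \int[@lebesgue_measure R]_(x in `]0, +oo[) u0 x.

Definition w_init {R : realType} (u0 : R -> R) (x : R) : R :=
  expR (\int[@lebesgue_measure R]_(z in `]0, x]) u0 z).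

(* w x t is the positive classical solution on (0, L) x (0, oo) of
   w_t = w_xx, w(0, t) = 1, w(L, t) = e^M, w(., 0) = w_init u0. *)
Record hopf_cole_potential {R : realType} (u0 : R -> R) (L : R)
    (w : R -> R -> R) : Prop := HopfColePotential {
  hcp_pos : forall x t : R, 0 <= x <= L -> 0 <= t -> 0 < w x t ;
  hcp_continuous :
    {within `[0, L] `*` `[0, +oo[, continuous (fun p : R * R => w p.1 p.2)} ;
  hcp_derivable_t : forall x t : R, 0 < x < L -> 0 < t -> derivable (w x) t 1 ;
  hcp_derivable_x : forall x t : R, 0 < x < L -> 0 < t ->
    derivable (w ^~ t) x 1 ;
  hcp_derivable_xx : forall x t : R, 0 < x < L -> 0 < t ->
    derivable (derive1 (w ^~ t)) x 1 ;
  hcp_continuous_t : {within `]0, L[ `*` `]0, +oo[,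
    continuous (fun p : R * R => derive1 (w p.1) p.2)} ;
  hcp_continuous_x : {within `]0, L[ `*` `]0, +oo[,
    continuous (fun p : R * R => derive1 (w ^~ p.2) p.1)} ;
  hcp_continuous_xx : {within `]0, L[ `*` `]0, +oo[,
    continuous (fun p : R * R => derive1n 2 (w ^~ p.2) p.1)} ;
  hcp_heat : forall x t : R, 0 < x < L -> 0 < t ->
    derive1 (w x) t = derive1n 2 (w ^~ t) x ;
  hcp_left : forall t : R, 0 <= t -> w 0 t = 1 ;
  hcp_right : forall t : R, 0 <= t -> w L t = expR (mass u0) ;
  hcp_init : forall x : R, 0 <= x <= L -> w x 0 = w_init u0 x
}.

(* u = w_x / w on [0, L], with w_x one-sided at x = 0 and x = L. *)
Definition hopf_cole {R : realType} (L : R) (w : R -> R -> R) (x t : R) : R :=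
  derive_in `[0, L] (w ^~ t) x / w x t.

Definition rescale {R : realType} (u : R -> R -> R) (xi t : R) : R :=
  Num.sqrt t * u (xi * Num.sqrt t) t.

(* The series is used for tau > 0 only; it then converges for all real y. *)
Definition phi {R : realType} (y tau : R) : R :=
  y + 2 / pi * limn (fun N => \sum_(1 <= n < N)
    sin (n%:R * pi * y) / n%:R * expR (- (n%:R ^+ 2 * pi ^+ 2 * tau))).

Definition Phi {R : realType} (M c xi : R) : R :=
  Num.sqrt c *
  ((expR M - 1) * derive1 (phi ^~ c) (xi * Num.sqrt c) /
   (1 + (expR M - 1) * phi (xi * Num.sqrt c) c)).

(* Main.v *)
Require Import Defs.
From mathcomp Require Import ring lra.

Local Open Scope classical_set_scope.
Local Open Scope ring_scope.

(* After rescaling to y = x / L, tau = t / L^2, the maximum principle identifies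
   w(., c L^2) with its sine series: the initial datum is approximated uniformly
   by sine polynomials, for which the series solution is explicit.  The profile
   Phi_c comes in the same way from the datum e^M, with the boundary value 1 at
   0.  Both data differ on [0, R0 / L] only, so their sine coefficients differ
   by O(1 / L) uniformly in n, and the factors exp(- n^2 pi^2 c) turn this into
   O(1 / L) bounds for all derivatives of the difference.  The potentials being
   bounded below by exp(- ||u0||_1), again by the maximum principle, the estimate
   passes to the logarithmic derivatives. *)

(** * The maximum principle *)

(** The datum of [phi] does not match the boundary value 0, so that solution is discontinuous at the
    corner (0, 0) and the maximum principle reaches it only through continuous ramps. Nor is any
    series followed down to time 0: a sine polynomial solution is compared with the true solution at
    time 0 and with the series at time [c]. On derivatives at the ends of the interval
    [hopf_cole_potential] says nothing; they come from the series, which is smooth on the whole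
    line. The constant may depend on [u0] only through K = ||u0||_1 and not on [L], hence the jet
    estimates fix their constants before the functions. The two data differ by at most exp K on an
    interval of length R0 / L, whence the coefficient error 2 exp K R0 / L. *)

Lemma is_derive1_dist {R : realType} (f : R -> R) (x a : R) :
  is_derive x 1 f a <->
  forall e, 0 < e -> exists2 d, 0 < d & forall h, `|h| < d ->
    `|f (x + h) - f x - a * h| <= e * `|h|.
Proof.
have E (h : R) : h != 0 ->
    `|a - h^-1 *: ((f \o shift x) (h *: 1) - f x)| * `|h| =
    `|f (x + h) - f x - a * h|.
  move=> h0; rewrite /= /GRing.scale/= mulr1 -normrM mulrBl (mulrC h^-1) mulfVK//.
  by rewrite distrC (addrC h).
split=> [[/cvgrPdist_le df dfa] e e0|H].
  rewrite [lim _]dfa in df.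
  have /nbhs_ballP[d /= d0 hd] := df e e0.
  exists d => // h hd'; have [->|h0] := eqVneq h 0.
    by rewrite addr0 subrr mulr0 subrr !normr0 mulr0.
  rewrite -E// ler_pM2r ?normr_gt0//; apply: hd => //=.
  by rewrite /ball/= sub0r normrN.
have cv : (fun h : R => h^-1 *: ((f \o shift x) (h *: (1:R)) - f x)) @ 0^' --> a.
  apply/cvgrPdist_le => e /H[d d0 hd]; near=> h.
  have h0 : h != 0 by near: h; exact: nbhs_dnbhs_neq.
  rewrite -(ler_pM2r (x:=`|h|)) ?normr_gt0// E//; apply: hd.
  by near: h; apply: dnbhs0_lt.
by apply: DeriveDef; [apply: cvgP cv|apply: cvg_lim].
Unshelve. all: by end_near. Qed.

(** Only earlier times are compared, because a maximum over a closed time interval may be attained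
    at its final time. *)
Lemma is_derive1_left_max {R : realType} (f : R -> R) (x a d : R) : 0 < d ->
  is_derive x 1 f a -> (forall y, x - d < y < x -> f y <= f x) -> 0 <= a.
Proof.
move=> d0 /is_derive1_dist df fx; rewrite leNgt; apply/negP => a0.
have [|e e0 he] := df (- a / 2); first lra.
pose h := - (Num.min d e / 2).
have m0 : 0 < Num.min d e by rewrite lt_min d0 e0.
have nh : `|h| = Num.min d e / 2 by rewrite normrN gtr0_norm// divr_gt0.
have := he h; rewrite nh; have [med mee] : Num.min d e <= d /\ Num.min d e <= e.
  by split; rewrite ge_min lexx ?orbT.
have hh : h = - (Num.min d e / 2) by [].
move=> /(_ ltac:(lra)) /ler_normlP[+ _]; have := fx (x + h).
move=> /(_ ltac:(apply/andP; split; lra)).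
set m := Num.min d e in m0 med mee nh hh *.
nra.
Qed.

(** If [c > 0], then [g x = 0] makes [g] positive just to the right of [x], and the mean value
    theorem pushes [f] above its maximum. *)
Lemma snd_derive_max {R : realType} (f g : R -> R) (a b x c : R) :
  a < x < b -> (forall y, a < y < b -> is_derive y 1 f (g y)) ->
  is_derive x 1 g c -> (forall y, a < y < b -> f y <= f x) -> c <= 0.
Proof.
move=> /andP[ax xb] df dg fx; rewrite leNgt; apply/negP => c0.
have gx0 : g x = 0.
  have dfx : is_derive x 1 f 0.
    apply: (@derive1_at_max _ f a b); rewrite ?in_itv/= ?ax ?xb//.
    - exact/ltW/(lt_trans ax).
    - by move=> t; rewrite in_itv/= => /df [].
  have dfx' : is_derive x 1 f (g x) by apply: df; rewrite ax.
  by case: dfx' => _ <-; case: dfx => _ <-.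
have [|e e0 he] := (is_derive1_dist _ _ _).1 dg (c / 2); first lra.
have m0 : 0 < Num.min e (b - x) by rewrite lt_min e0 subr_gt0.
have [me mb] : Num.min e (b - x) <= e /\ Num.min e (b - x) <= b - x.
  by split; rewrite ge_min lexx ?orbT.
set m := Num.min e (b - x) in m0 me mb.
have [|y yx||y] := @MVT _ f g x (x + m / 2); first lra.
- by apply: df; move: yx; rewrite in_itv/= => /andP[? ?]; apply/andP; split; lra.
- apply: derivable_within_continuous => y; rewrite in_itv/= => /andP[? ?].
  by have [|] := df y; first (apply/andP; split; lra).
rewrite in_itv/= => /andP[xy ym].
have := fx (x + m / 2); move=> /(_ ltac:(apply/andP; split; lra)) fm E.
have := he (y - x); rewrite gtr0_norm ?subr_gt0// => /(_ ltac:(lra)).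
rewrite subrKC gx0 => /ler_normlP[h1 _].
have : 0 < g y by nra.
nra.
Qed.

(* [a] is at once the time derivative and the second space derivative of [z];
   carrying witnesses makes the class visibly closed under linear operations. *)
Definition heat_sol {R : realType} (z : R -> R -> R) : Prop :=
  {within `[0, 1] `*` `[0, +oo[, continuous (fun p : R * R => z p.1 p.2)} /\
  forall t : R, 0 < t -> exists g a : R -> R, forall x : R, 0 < x < 1 ->
    [/\ is_derive x 1 (z ^~ t) (g x), is_derive x 1 g (a x) &
        is_derive t 1 (z x) (a x)].

(** The perturbation [- n * t] makes the contradiction strict: at an interior maximum the second
    space derivative [a y] is at most 0, while the time derivative [a y - n] is at least 0. *)
Lemma heat_sol_le {R : realType} (z : R -> R -> R) (B : R) :
  heat_sol z ->
  (forall t, 0 <= t -> z 0 t <= B /\ z 1 t <= B) ->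
  (forall x, 0 <= x <= 1 -> z x 0 <= B) ->
  forall x t, 0 <= x <= 1 -> 0 <= t -> z x t <= B.
Proof.
move=> [zc hz] zb zi x t x01 t0.
apply/ler_addgt0Pr => e e0.
have t10 : 0 < t + 1 by lra.
(* Dividing by [t + 1] rather than [t] covers [t = 0]; the perturbation at time [t] costs at most
   [e]. *)
pose n := e / (t + 1); have n0 : 0 < n by exact: divr_gt0.
have ne : n * t <= e.
  rewrite /n mulrAC ler_pdivrMr// ler_pM2l//; lra.
pose K : set (R * R) := `[0, 1] `*` `[0, t].
pose q (p : R * R) := z p.1 p.2 - n * p.2.
have [|||[y s]] := @compact_EVT_max _ _ q K.
- by exists (0, 0); split; rewrite /= in_itv/= ?lexx ?ler01.
- by apply: compact_setX; exact: segment_compact.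
- have zK : {within K, continuous (fun p : R * R => z p.1 p.2)}.
    apply: continuous_subspaceW zc => -[u v] [/= ? ]; rewrite in_itv/= => /andP[? ?].
    by split => //=; rewrite in_itv/= andbT.
  have nK : {within K, continuous (fun p : R * R => - (n * p.2))}.
    apply: continuous_subspaceT => p; apply: cvgN; apply: cvgMr.
    exact: cvg_snd.
  by move=> p; apply: cvgD; [exact: zK|exact: nK].
rewrite inE => -[/=]; rewrite !in_itv/= => /andP[y0 y1] /andP[s0 st] qmax.
have qm u v : 0 <= u <= 1 -> 0 <= v <= t -> z u v - n * v <= z y s - n * s.
  by move=> hu hv; apply: (qmax (u, v)); rewrite inE; split; rewrite /= in_itv.
suff zs : z y s <= B.
  have := qm x t x01; rewrite t0 lexx => /(_ isT); nra.
have [->|sn0] := eqVneq s 0; first by apply: zi; rewrite y0.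
have [->|yn0] := eqVneq y 0; first by have [] := zb s s0.
have [->|yn1] := eqVneq y 1; first by have [] := zb s s0.
have {}s0 : 0 < s by rewrite lt_def sn0.
have {}y0 : 0 < y by rewrite lt_def yn0.
have {}y1 : y < 1 by rewrite lt_def eq_sym yn1.
have [g [a ga]] := hz s s0.
have [gy gy' zt] := ga y ltac:(by rewrite y0).
have a0 : a y <= 0.
  apply: (@snd_derive_max _ (z ^~ s) g 0 1 y) => //; first by rewrite y0.
    by move=> u /ga[].
  move=> u /andP[? ?]; have := qm u s; rewrite st (ltW s0) => /(_ _ isT).
  by move=> /(_ ltac:(apply/andP; split; lra)); lra.
have : 0 <= a y - n.
  apply: (@is_derive1_left_max _ (fun v => z y v - n * v) s (a y - n) s) => //.
    have : is_derive s 1 (z y \- (n \*: id)) (a y - n *: 1).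
      exact: is_deriveB.
    by rewrite /GRing.scale/= mulr1.
  move=> v /andP[v0 vs]; apply: qm; apply/andP; split; lra.
lra.
Qed.

(** * Uniform density of sine polynomials *)

(* The Bernstein polynomial of [k / n |-> g k], computed by conditioning the
   binomial law on its first trial, which avoids binomial coefficients. *)
Fixpoint bernstein {R : realType} (n : nat) (g : nat -> R) (x : R) : R :=
  if n is n'.+1 then
    (1 - x) * bernstein n' g x + x * bernstein n' (fun k => g k.+1) x
  else g 0%N.

Lemma bernstein_le {R : realType} (n : nat) (g h : nat -> R) (x : R) :
  0 <= x <= 1 -> (forall k, (k <= n)%N -> g k <= h k) ->
  bernstein n g x <= bernstein n h x.
Proof.
move=> /andP[x0 x1]; elim: n g h => [|n IH] g h gh /=; first exact: gh.
by apply: lerD; apply: ler_wpM2l; rewrite ?subr_ge0//; apply: IH => k kn;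
  apply: gh => //; exact: leqW.
Qed.

Lemma bernstein_lin {R : realType} (n : nat) (a b : R) (g : nat -> R) (x : R) :
  bernstein n (fun k => a + b * g k) x = a + b * bernstein n g x.
Proof. by elim: n g => [|n IH] g //=; rewrite !IH; ring. Qed.

(** Second moment of the binomial law about [a]: variance plus squared bias. A free [a] lets the
    induction absorb the shift of [k] into [a - 1]. *)
Lemma bernstein_sqr {R : realType} (n : nat) (a x : R) :
  bernstein n (fun k => (k%:R - a) ^+ 2) x = n%:R * x * (1 - x) + (n%:R * x - a) ^+ 2.
Proof.
elim: n a => [|n IH] a /=; first by ring.
have -> : (fun k => (k.+1%:R - a) ^+ 2) = (fun k => (k%:R - (a - 1)) ^+ 2) :> (nat -> R).
  by apply/funext => k; rewrite -natr1; ring.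
by rewrite !IH -natr1; ring.
Qed.

(* The form of uniform continuity to which the variance bound [bernstein_sqr]
   applies directly. *)
Lemma quadratic_modulus {R : realType} (G s : R -> R) (e : R) :
  continuous G -> continuous s -> 0 < e ->
  (forall x y : R, 0 <= x <= 1 -> 0 <= y <= 1 -> s x = s y -> x = y) ->
  exists2 K : R, 0 <= K & forall x y : R, 0 <= x <= 1 -> 0 <= y <= 1 ->
    `|G x - G y| <= e + K * (s x - s y) ^+ 2.
Proof.
move=> cG cs e0 sinj.
have [M M0 GM] : exists2 M : R, 0 <= M & forall x : R, 0 <= x <= 1 -> `|G x| <= M.
  have [||x _ Gx] := @EVT_max _ (fun x => `|G x|) 0 1 => //.
    by apply: continuous_subspaceT => x; apply: cvg_norm; exact: cG.
  by exists `|G x| => // y y01; apply: Gx; rewrite in_itv.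
pose I : set (R * R) := `[0, 1] `*` `[0, 1].
pose D (p : R * R) := `|G p.1 - G p.2|.
have cD : continuous D.
  move=> p; apply: cvg_norm; apply: cvgB.
    by apply: continuous_comp; [exact: cvg_fst|exact: cG].
  by apply: continuous_comp; [exact: cvg_snd|exact: cG].
pose Q (p : R * R) := (s p.1 - s p.2) ^+ 2.
have cQ : continuous Q.
  move=> p; apply: (@continuous_comp _ _ _ (fun p : R * R => s p.1 - s p.2) (fun x => x ^+ 2)).
    apply: cvgB.
      by apply: continuous_comp; [exact: cvg_fst|exact: cs].
    by apply: continuous_comp; [exact: cvg_snd|exact: cs].
  exact: exprn_continuous.
(* Outside [C] the bound [e] suffices. On [C] the two points differ, so by compactness the squared
   difference of [s] has a positive minimum, and [2 * M] divided by it serves as [K]. *)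
pose C := I `&` D @^-1` [set x | e <= x].
have cC : compact C.
  apply: compact_closedI; first by apply: compact_setX; exact: segment_compact.
  by apply: (closed_comp (f := D)) => //; exact: closed_ge.
have inI x y : I (x, y) <-> 0 <= x <= 1 /\ 0 <= y <= 1.
  by rewrite /I /= !in_itv.
have [C0|C0] := pselect (C !=set0); last first.
  exists 0 => // x y hx hy; rewrite mul0r addr0 leNgt; apply/negP => /ltW h.
  by apply: C0; exists (x, y); split => //; exact/inI.
have [|/= [x y] + Qm] := @compact_EVT_min _ _ Q C C0 cC; first exact: continuous_subspaceT.
rewrite inE => -[/inI[hx hy] /= exy].
have Q0 : 0 < Q (x, y).
  rewrite /Q lt_def sqr_ge0 sqrf_eq0/= subr_eq0 andbT; apply/eqP => /sinj.
  by move=> /(_ hx hy) xy; move: exy; rewrite /D/= xy subrr normr0 leNgt e0.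
have M2 : 0 <= 2 * M by rewrite mulr_ge0.
exists (2 * M / Q (x, y)); first exact: divr_ge0 M2 (ltW Q0).
move=> u v hu hv; have [Ge|/ltW eG] := leP `|G u - G v| e.
  by rewrite (le_trans Ge)// lerDl mulr_ge0 ?sqr_ge0//; exact: divr_ge0 M2 (ltW Q0).
have : Q (x, y) <= (s u - s v) ^+ 2.
  by apply: (Qm (u, v)); rewrite inE; split => //; exact/inI.
move=> h.
have /(le_trans (ler_normB _ _)) : `|G u| + `|G v| <= 2 * M.
  by rewrite mulrDl !mul1r lerD ?GM.
move=> /le_trans; apply; rewrite -[leLHS]add0r lerD ?(ltW e0)//.
rewrite -mulrA -{1}[2 * M]mulr1 ler_wpM2l ?mulr_ge0//.
by rewrite mulrC ler_pdivlMr// mul1r.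
Qed.

Section sine_density.
Variable R : realType.
Variable S : (R -> R) -> Prop.
Hypothesis S_lin : forall (a b : R) (f g : R -> R),
  S f -> S g -> S (fun y => a * f y + b * g y).
Hypothesis S_sin : forall m : nat, S (fun y => sin (m%:R * pi * y)).

(** All frequencies [m] at once, since multiplication by cos (pi y) moves [m] to its two neighbours;
    thus polynomials in cos (pi y) act on the sines. *)
Let sin_mult (h : R -> R) := forall m : nat, S (fun y => sin (m%:R * pi * y) * h y).

Let sin_mult_lin (a b : R) (f g : R -> R) :
  sin_mult f -> sin_mult g -> sin_mult (fun y => a * f y + b * g y).
Proof.
move=> hf hg m; have := S_lin a b _ _ (hf m) (hg m).
by congr S; apply/funext => y; ring.
Qed.

Let sin_mult_cos (f : R -> R) : sin_mult f -> sin_mult (fun y => cos (pi * y) * f y).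
Proof.
(* At frequency 0 the sine vanishes, so no frequency -1 arises. *)
move=> hf [|m].
  have := S_lin 0 0 _ _ (S_sin 0) (S_sin 0); congr S; apply/funext => y.
  by rewrite !mul0r sin0 !mul0r addr0.
have := S_lin 2^-1 2^-1 _ _ (hf m.+2) (hf m).
congr S; apply/funext => y.
have -> : m.+2%:R * pi * y = m.+1%:R * pi * y + pi * y by rewrite -!natr1; ring.
have -> : m%:R * pi * y = m.+1%:R * pi * y - pi * y by rewrite -!natr1; ring.
by rewrite sinD sinB; field.
Qed.

Let sin_mult_bernstein n (g : nat -> R) :
  sin_mult (fun y => bernstein n g ((1 - cos (pi * y)) / 2)).
Proof.
elim: n g => [|n IH] g /=.
  move=> m; have := S_lin (g 0%N) 0 _ _ (S_sin m) (S_sin m).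
  by congr S; apply/funext => y; ring.
have IH' := IH (fun k => g k.+1).
have := sin_mult_lin 2^-1 2^-1 _ _
  (sin_mult_lin 1 1 _ _ (IH g) (sin_mult_cos _ (IH g)))
  (sin_mult_lin 1 (-1) _ _ IH' (sin_mult_cos _ IH')).
by congr sin_mult; apply/funext => y; field.
Qed.

(* [f], truncated so as to vanish near 0 and 1, is [sin (pi y)] times a continuous
   function of [cos (pi y)], and the latter is approximated by its Bernstein
   polynomials in [(1 - cos (pi y)) / 2]. *)
Lemma sine_density (f : R -> R) (e : R) : continuous f ->
  (forall y : R, y <= 0 \/ 1 <= y -> f y = 0) -> 0 < e ->
  exists2 P, S P & forall y : R, 0 <= y <= 1 -> `|f y - P y| <= e.
Proof.
move=> cf f0 e0.
pose e3 := e / 3; have e30 : 0 < e3 by rewrite divr_gt0.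
(* Soft thresholding: [fe] is [f] minus its truncation to [-e3, e3]. *)
pose fe y := f y + (`|f y - e3| - `|f y + e3|) / 2.
have fef y : `|f y - fe y| <= e3.
  rewrite /fe; have := ler_norm (f y); rewrite ler_norml.
  by case: (ger0P (f y - e3)) => ?; case: (ger0P (f y + e3)) => ? _; apply/andP; split; lra.
have fe0 y : `|f y| < e3 -> fe y = 0.
  by rewrite ltr_norml => /andP[? ?]; rewrite /fe ltr0_norm ?gtr0_norm; lra.
pose G y := fe y / sin (pi * y).
have cG : continuous G.
  move=> y; have [fy|fy] := ltP `|f y| e3.
    have Gy : G y = 0 by rewrite /G fe0// mul0r.
    have c0 : (fun=> 0 : R) @ y --> (0 : R) by exact: cvg_cst.
    rewrite /continuous_at Gy; apply: cvg_trans c0; apply: near_eq_cvg.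
    have : \forall z \near y, `|f z| < e3.
      have : (fun z => `|f z|) @ y --> `|f y| by apply: cvg_norm; exact: cf.
      by move=> /(_ _ (lt_nbhsl fy)).
    by apply: filterS => z fz; rewrite /G fe0// mul0r.
  have y01 : 0 < y < 1.
    rewrite !ltNge -negb_or; apply/negP => /orP h.
    by move: fy; rewrite f0// normr0 leNgt e30.
  have sy : sin (pi * y) != 0.
    rewrite gt_eqF// sin_gt0_pi//.
    by case/andP: y01 => ? ?; rewrite mulr_gt0 ?pi_gt0//= gtr_pMr ?pi_gt0.
  apply: cvgM; last first.
    apply: cvgV => //; apply: continuous_comp; last exact: continuous_sin.
    by apply: cvgMr; exact: cvg_id.
  apply: cvgD; first exact: cf.
  apply: cvgMl; apply: cvgB; apply: cvg_norm.
    by apply: cvgB; [exact: cf|exact: cvg_cst].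
  by apply: cvgD; [exact: cf|exact: cvg_cst].
pose s (y : R) := (1 - cos (pi * y)) / 2.
have s01 y : 0 <= s y <= 1.
  by rewrite /s; have := cos_le1 (pi * y); have := cos_geN1 (pi * y) => ? ?; apply/andP; split; lra.
have cs : continuous s.
  move=> y; apply: cvgMl; apply: cvgB; first exact: cvg_cst.
  apply: continuous_comp; last exact: continuous_cos.
  by apply: cvgMr; exact: cvg_id.
have piI (x : R) : 0 <= x <= 1 -> pi * x \in `[0, pi].
  by case/andP => ? ?; rewrite in_itv/= mulr_ge0 ?pi_ge0//= ger_pMr ?pi_gt0.
have [|K K0 HK] := quadratic_modulus _ _ _ cG cs e30.
  move=> x y hx hy sxy; have /cos_inj : cos (pi * x) = cos (pi * y) by move: sxy; rewrite /s; lra.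
  by move=> /(_ (piI _ hx) (piI _ hy)) /mulfI; apply; rewrite gt_eqF ?pi_gt0.
(* The variance contributes [K * s * (1 - s) / n], which this [n] brings below [e3]. *)
pose n := (Num.truncn (K / e3)).+1.
have nK : K / n%:R <= e3.
  rewrite ler_pdivrMr ?ltr0n// mulrC -ler_pdivrMr//.
  exact/ltW/truncnS_gt.
have n0 : (0 : R) < n%:R by rewrite ltr0n.
(* Nodes solving [s (yk k) = k / n]. *)
pose yk (k : nat) : R := acos (1 - 2 * (k%:R / n%:R)) / pi.
have syk k : (k <= n)%N -> s (yk k) = k%:R / n%:R /\ 0 <= yk k <= 1.
  move=> kn; have hk : 0 <= (k%:R / n%:R : R) <= 1.
    by rewrite divr_ge0//= ler_pdivrMr// mul1r ler_nat.
  have ha : -1 <= (1 - 2 * (k%:R / n%:R) : R) <= 1.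
    by case/andP: hk => ? ?; apply/andP; split; lra.
  split; last first.
    by rewrite /yk divr_ge0 ?acos_ge0 ?pi_ge0//= ler_pdivrMr ?pi_gt0// mul1r acos_lepi.
  rewrite /s /yk mulrCA mulfV ?gt_eqF ?pi_gt0// mulr1 acosK ?in_itv//.
  by field; rewrite gt_eqF.
exists (fun y => sin (pi * y) * bernstein n (fun k => G (yk k)) (s y)).
  have := sin_mult_bernstein n (fun k => G (yk k)) 1.
  by congr S; apply/funext => y; rewrite mul1r.
move=> y y01; set P := bernstein _ _ _.
have GP : `|G y - P| <= 2 * e3.
  (* The bound [A k] on the oscillation of [G] passes through the positive operator [bernstein],
     which evaluates it by the second moment. *)
  pose A k : R := e3 + K / n%:R ^+ 2 * (k%:R - n%:R * s y) ^+ 2.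
  have GA k : (k <= n)%N -> `|G y - G (yk k)| <= A k.
    move=> /syk[sk yk01]; apply: le_trans (HK _ _ y01 yk01) _.
    rewrite sk lerD2l le_eqVlt; apply/orP; left; apply/eqP.
    by field; rewrite gt_eqF.
  have EA : bernstein n A (s y) <= 2 * e3.
    rewrite bernstein_lin bernstein_sqr subrr expr0n addr0.
    suff : K / n%:R ^+ 2 * (n%:R * s y * (1 - s y)) <= e3 by lra.
    have -> : K / n%:R ^+ 2 * (n%:R * s y * (1 - s y)) = K / n%:R * (s y * (1 - s y)).
      by field; rewrite gt_eqF.
    apply: le_trans nK; rewrite ler_piMr ?divr_ge0 ?(ltW n0)//.
    have /andP[? ?] := s01 y; nra.
  have P1 : P <= G y + bernstein n A (s y).
    rewrite -[X in _ + X]mul1r -bernstein_lin; apply: bernstein_le => // k /GA.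
    by rewrite mul1r ler_norml => /andP[? ?]; lra.
  have P2 : G y + -1 * bernstein n A (s y) <= P.
    rewrite -bernstein_lin; apply: bernstein_le => // k /GA.
    by rewrite ler_norml => /andP[? ?]; lra.
  by rewrite ler_norml; apply/andP; split; lra.
have feG : fe y = sin (pi * y) * G y.
  have [sy|sy] := eqVneq (sin (pi * y)) 0; last by rewrite /G mulrC mulfVK.
  rewrite sy mul0r fe0// f0 ?normr0//.
  have /andP[y0 y1] := y01; have [y0'|y0'] := leP y 0; first by left.
  have [y1'|y1'] := leP 1 y; first by right.
  have : 0 < sin (pi * y).
    by rewrite sin_gt0_pi// mulr_gt0 ?pi_gt0//= gtr_pMr ?pi_gt0.
  by rewrite sy ltxx.
have -> : f y - sin (pi * y) * P = (f y - fe y) + sin (pi * y) * (G y - P).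
  by rewrite mulrBr -feG; ring.
have h := fef y; apply: le_trans (ler_normD _ _) _.
have : `|sin (pi * y) * (G y - P)| <= 2 * e3.
  rewrite normrM; apply: le_trans (ler_wpM2r _ _) _; first exact: normr_ge0.
    have := sin_le1 (pi * y); have := sin_geN1 (pi * y) => ? ?.
    by rewrite ler_norml; apply/andP; split; eassumption.
  by rewrite mul1r.
move: h; rewrite /e3 => ? ?; lra.
Qed.

End sine_density.

(** * Heat series *)

(** Valid for either order of [x] and [y], and the bound on [z - x] allows a second application at
    [z]. *)
Lemma MVT_between {R : realType} (f df : R -> R) (x y : R) :
  (forall z : R, is_derive z 1 f (df z)) ->
  exists2 z, `|z - x| <= `|y - x| & f y - f x = df z * (y - x).
Proof.
move=> hf; have cf a b : {within `[a, b], continuous f}.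
  by apply: derivable_within_continuous => z _; case: (hf z).
have [xy|/ltW yx] := leP x y.
  have [z] := @MVT_segment _ f df x y xy (fun z _ => hf z) (cf x y).
  rewrite in_itv/= => /andP[xz zy] ->; exists z => //.
  by rewrite !ger0_norm ?subr_ge0// lerB.
have [z] := @MVT_segment _ f df y x yx (fun z _ => hf z) (cf y x).
rewrite in_itv/= => /andP[xz zy] E; exists z; last by rewrite -opprB E; ring.
by rewrite !ler0_norm ?subr_le0// lerN2 lerB.
Qed.

Lemma sin_taylor1 {R : realType} (x h : R) :
  `|sin (x + h) - sin x - h * cos x| <= h ^+ 2.
Proof.
have [z zh E] := MVT_between sin cos x (x + h) (@is_derive_sin R).
have [w _ Ew] := MVT_between cos (fun y => - sin y) x z (@is_derive_cos R).
rewrite (addrC x) addrK in zh E; rewrite (addrC x) E mulrC -mulrBr Ew.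
rewrite !normrM normrN -(real_normK (num_real h)) expr2 ler_wpM2l//.
rewrite -[leRHS]mul1r ler_pM// ler_norml.
by rewrite sin_geN1 sin_le1.
Qed.

(** Amplitude at time [c] of the [j]-th space derivative of the [n]-th mode. *)
Definition heat_weight {R : realType} (c : R) (j n : nat) : R :=
  expR (- (n%:R ^+ 2 * pi ^+ 2 * c)) * (n%:R * pi) ^+ j.

Definition heat_term {R : realType} (c : R) (j : nat) (a : nat -> R) (y : R) (n : nat) : R :=
  a n * heat_weight c j n * sin (n%:R * pi * y + j%:R * (pi / 2)).

(* The [j]-th [y]-derivative, at time [c], of the solution of the heat equation
   on [0, 1] with sine coefficients [a]: differentiation shifts the phase by
   pi / 2.  The term of index [0] vanishes. *)
Definition heat_series {R : realType} (c : R) (j : nat) (a : nat -> R) (y : R) : R :=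
  limn (series (heat_term c j a y)).

Lemma heat_weight_ge0 {R : realType} (c : R) (j n : nat) : 0 <= heat_weight c j n.
Proof. by rewrite mulr_ge0 ?expR_ge0// exprn_ge0// mulr_ge0// pi_ge0. Qed.

Lemma exprn_le_fact_expR {R : realType} (x : R) (n : nat) : 0 <= x ->
  x ^+ n <= n`!%:R * expR x.
Proof.
case: n => [|n] x0; first by rewrite expr0 fact0 mul1r -expR0 ler_expR.
rewrite mulrC -ler_pdivrMr ?ltr0n ?fact_gt0//; apply: le_trans (expR_ge1Dxn n x0).
by rewrite lerDr.
Qed.

Lemma cvg_heat_weight {R : realType} (c : R) (j : nat) : 0 < c ->
  cvgn (series (@heat_weight R c j)).
Proof.
(* As n^2 >= n, the Gaussian exponent is at least [2 * n * b]: one half absorbs the power of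
   [n * pi], the other leaves a geometric series. *)
move=> c0; pose b : R := pi ^+ 2 * c / 2.
have b0 : 0 < b by rewrite divr_gt0// mulr_gt0// exprn_gt0// pi_gt0.
pose K : R := (pi / b) ^+ j * j`!%:R.
have K0 : 0 <= K by rewrite mulr_ge0// exprn_ge0// divr_ge0 ?pi_ge0 ?ltW.
apply: (@series_le_cvg _ _ (geometric K (expR (- b)))).
- exact: heat_weight_ge0.
- by move=> n; rewrite /= mulr_ge0// exprn_ge0// expR_ge0.
- move=> n; rewrite /heat_weight /geometric/= -expRM_natl.
  have -> : n%:R * pi = pi / b * (n%:R * b) by field; rewrite gt_eqF.
  rewrite exprMn mulrCA -[leRHS]mulrA ler_wpM2l//.
    by rewrite exprn_ge0// divr_ge0 ?pi_ge0// ltW.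
  have := @exprn_le_fact_expR _ (n%:R * b) j (mulr_ge0 (ler0n _ _) (ltW b0)).
  move=> /(ler_wpM2l (expR_ge0 (- (n%:R ^+ 2 * pi ^+ 2 * c)))) /le_trans; apply.
  rewrite mulrCA ler_wpM2l// -expRD ler_expR.
  rewrite mulrN -subr_ge0 /b.
  have -> : - (n%:R * (pi ^+ 2 * c / 2)) -
    (- (n%:R ^+ 2 * pi ^+ 2 * c) + n%:R * (pi ^+ 2 * c / 2)) =
    n%:R * (n%:R - 1) * (pi ^+ 2 * c) :> R by field.
  rewrite mulr_ge0//; last by rewrite mulr_ge0 ?exprn_ge0 ?pi_ge0// ltW.
  by case: n => [|n]; rewrite ?mul0r// mulr_ge0// subr_ge0 ler1n.
- by apply: is_cvg_geometric_series; rewrite ger0_norm ?expR_ge0// expR_lt1 oppr_lt0.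
Qed.

Lemma norm_heat_term {R : realType} (c A : R) (j : nat) (a : nat -> R) (y : R) (n : nat) :
  (forall n, `|a n| <= A) -> `|heat_term c j a y n| <= A * heat_weight c j n.
Proof.
move=> aA; rewrite 2!normrM (ger0_norm (heat_weight_ge0 _ _ _)) -[leRHS]mulr1.
have w0 := heat_weight_ge0 c j n.
rewrite ler_pM ?(mulr_ge0 (normr_ge0 (a n)) w0) ?ler_wpM2r//.
by rewrite ler_norml sin_geN1 sin_le1.
Qed.

Lemma series_dominated {R : realType} (u v : nat -> R) :
  (forall n, `|u n| <= v n) -> cvgn (series v) ->
  cvgn (series u) /\ `|limn (series u)| <= limn (series v).
Proof.
move=> uv cv; have cu : cvgn [normed series u].
  apply: (@series_le_cvg _ _ v) => // n; first exact: normr_ge0.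
  exact: le_trans (normr_ge0 _) (uv n).
split; first exact: normed_cvg.
by apply: le_trans (lim_series_norm cu) _; exact: lim_series_le.
Qed.

Lemma heat_series_bound {R : realType} (c A : R) (j : nat) (a : nat -> R) (y : R) :
  0 < c -> (forall n, `|a n| <= A) ->
  cvgn (series (heat_term c j a y)) /\
  `|heat_series c j a y| <= A * limn (series (heat_weight c j)).
Proof.
move=> c0 aA; have cw := cvg_heat_weight c j c0.
have [||cu bu] := @series_dominated _ (heat_term c j a y) (A *: (heat_weight c j : R^nat)).
- by move=> n; exact: norm_heat_term.
- exact: is_cvg_seriesZ.
by split=> //; rewrite lim_seriesZ in bu.
Qed.

Lemma heat_series_lin {R : realType} (c A B p q : R) (j : nat) (a b : nat -> R) (y : R) :
  0 < c -> (forall n, `|a n| <= A) -> (forall n, `|b n| <= B) ->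
  heat_series c j (fun n => p * a n + q * b n) y =
  p * heat_series c j a y + q * heat_series c j b y.
Proof.
move=> c0 aA bB.
have [ca _] := heat_series_bound c A j a y c0 aA.
have [cb _] := heat_series_bound c B j b y c0 bB.
rewrite /heat_series -[p * _]/(p *: _) -[q * _]/(q *: _) -!lim_seriesZ//.
rewrite -lim_seriesD; [|exact: is_cvg_seriesZ..].
congr (limn (series _)); apply/funext => n.
rewrite -[RHS]/(p * _ + q * _) /heat_term; ring.
Qed.

(** Quadratic remainders are summed term by term, so differentiability of the series follows without
    a theorem on exchanging limits; the two extra powers of [n * pi] turn the weight [j] into
    [j.+2]. *)
Lemma heat_series_taylor1 {R : realType} (c A : R) (j : nat) (a : nat -> R) (y h : R) :
  0 < c -> (forall n, `|a n| <= A) ->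
  `|heat_series c j a (y + h) - heat_series c j a y - heat_series c j.+1 a y * h|
    <= A * limn (series (heat_weight c j.+2)) * h ^+ 2.
Proof.
move=> c0 aA.
have [c1 _] := heat_series_bound c A j a (y + h) c0 aA.
have [c2 _] := heat_series_bound c A j a y c0 aA.
have [c3 _] := heat_series_bound c A j.+1 a y c0 aA.
have cw := cvg_heat_weight c j.+2 c0.
rewrite /heat_series (mulrC _ h) -[h * _]/(h *: _) -lim_seriesZ//.
rewrite -lim_seriesB// -lim_seriesB; [|exact: is_cvg_seriesB|exact: is_cvg_seriesZ].
rewrite mulrAC -[leRHS]/((A * h ^+ 2) *: _) -lim_seriesZ//.
apply: (@series_dominated _ _ (_ *: (heat_weight c j.+2 : R^nat)) _ _).2; last exact: is_cvg_seriesZ.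
move=> n; set t : R := n%:R * pi * y + j%:R * (pi / 2).
have -> : (heat_term c j a (y + h) - heat_term c j a y - h *: (heat_term c j.+1 a y : R^nat)) n =
    a n * heat_weight c j n *
    (sin (t + n%:R * pi * h) - sin t - n%:R * pi * h * cos t).
  rewrite -[LHS]/(_ - _ - h * _) /heat_term.
  have -> : n%:R * pi * y + j.+1%:R * (pi / 2) = t + pi / 2.
    by rewrite -natr1 /t; ring.
  rewrite sinD sin_pihalf cos_pihalf mulr0 add0r mulr1.
  have -> : n%:R * pi * (y + h) + j%:R * (pi / 2) = t + n%:R * pi * h by rewrite /t; ring.
  rewrite -/t.
  by rewrite /heat_weight [_ ^+ j.+1]exprS; ring.
rewrite 2!normrM (ger0_norm (heat_weight_ge0 _ _ _)).
have -> : ((A * h ^+ 2) *: (heat_weight c j.+2 : R^nat)) n =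
    A * heat_weight c j n * (n%:R * pi * h) ^+ 2.
  by rewrite -[LHS]/(_ * _) /heat_weight [_ ^+ j.+2]exprS [_ ^+ j.+1]exprS; ring.
have w0 := heat_weight_ge0 c j n.
by rewrite ler_pM ?(mulr_ge0 (normr_ge0 (a n)) w0) ?ler_wpM2r ?sin_taylor1.
Qed.

Lemma is_derive_heat_series {R : realType} (c A : R) (j : nat) (a : nat -> R) (y : R) :
  0 < c -> (forall n, `|a n| <= A) ->
  is_derive y 1 (heat_series c j a) (heat_series c j.+1 a y).
Proof.
move=> c0 aA; apply/is_derive1_dist => e e0.
set K := A * limn (series (heat_weight c j.+2)).
have Kp : 0 < `|K| + 1 by rewrite ltr_wpDl.
exists (e / (`|K| + 1)); first exact: divr_gt0.
move=> h /ltW hd; apply: le_trans (heat_series_taylor1 c A j a y h c0 aA) _.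
rewrite -/K -real_normK ?num_real// expr2 mulrA ler_wpM2r//.
move: hd; rewrite ler_pdivlMr//; apply: le_trans; rewrite mulrC ler_wpM2l//.
by rewrite (le_trans (ler_norm K))// lerDl.
Qed.

Lemma phi_heat_series {R : realType} (c y : R) : 0 < c ->
  phi y c = y + heat_series c 0 (fun n => 2 / (n%:R * pi)) y.
Proof.
move=> c0; rewrite /phi; congr (_ + _).
(* The inverse of 0 is 0, so [b 0 = 0] and the sum may start at index 0 or at 1. *)
pose b (n : nat) : R := n%:R^-1.
have b1 n : `|b n| <= 1.
  rewrite /b ger0_norm ?invr_ge0//; case: n => [|n]; first by rewrite invr0.
  by rewrite invf_le1 ?ler1n ?ltr0n.
have -> : (fun n => 2 / (n%:R * pi)) = (fun n => 2 / pi * b n + 0 * b n) :> (nat -> R).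
  by apply/funext => n; rewrite mul0r addr0 /b invfM; ring.
rewrite (heat_series_lin c 1 1)// mul0r addr0; rewrite /heat_series.
set u := (fun N : nat => _); suff -> : u = series (heat_term c 0 b y) by [].
apply/funext => N; rewrite /u /series/=.
have E n : sin (n%:R * pi * y) / n%:R * expR (- (n%:R ^+ 2 * pi ^+ 2 * c)) = heat_term c 0 b y n.
  by rewrite /heat_term /heat_weight expr0 mul0r addr0 /b; ring.
under eq_bigr do rewrite E.
case: N => [|N]; first by rewrite !big_geq.
rewrite [RHS]big_nat_recl// big_add1/= [X in _ = X + _](_ : _ = 0) ?add0r//.
by rewrite /heat_term /b invr0 !mul0r.
Qed.

(** * Sine coefficients *)

Definition fourier_sin {R : realType} (f : R -> R) (n : nat) : R :=
  2 * \int[@lebesgue_measure R]_(x in `[0, 1]) (f x * sin (n%:R * pi * x)).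

Lemma continuous_lin {R : realType} (w : R) : continuous (fun x : R => w * x).
Proof. by move=> x; apply: cvgMr; exact: cvg_id. Qed.

Lemma continuous_sin_lin {R : realType} (w : R) : continuous (fun x : R => sin (w * x)).
Proof.
by move=> x; apply: continuous_comp; [exact: continuous_lin|exact: continuous_sin].
Qed.

Lemma continuous_cos_lin {R : realType} (w : R) : continuous (fun x : R => cos (w * x)).
Proof.
by move=> x; apply: continuous_comp; [exact: continuous_lin|exact: continuous_cos].
Qed.

Lemma is_derive_lin {R : realType} (w x : R) : is_derive x 1 (fun x : R => w * x) w.
Proof.
have : is_derive x 1 (w \*: id) (w *: (1 : R)) by exact: is_deriveZ.
by rewrite /GRing.scale/= mulr1.
Qed.

Lemma is_derive_sin_lin {R : realType} (w x : R) :
  is_derive x 1 (fun x : R => sin (w * x)) (w * cos (w * x)).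
Proof. by rewrite mulrC; apply: is_derive1_comp; exact: is_derive_lin. Qed.

Lemma is_derive_cos_lin {R : realType} (w x : R) :
  is_derive x 1 (fun x : R => cos (w * x)) (- (w * sin (w * x))).
Proof. by rewrite mulrC -mulNr; apply: is_derive1_comp; exact: is_derive_lin. Qed.

Lemma continuous_integrable {R : realType} (f : R -> R) (a b : R) : continuous f ->
  (@lebesgue_measure R).-integrable `[a, b] (EFin \o f).
Proof.
move=> cf; apply: continuous_compact_integrable; first exact: segment_compact.
exact: continuous_subspaceT.
Qed.

Lemma Rintegral01_FTC {R : realType} (f F : R -> R) : continuous f ->
  (forall x : R, is_derive x 1 F (f x)) ->
  \int[@lebesgue_measure R]_(x in `[0, 1]) f x = F 1 - F 0.
Proof.
move=> cf dF; have cF : continuous F.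
  by move=> x; apply/differentiable_continuous/derivable1_diffP; case: (dF x).
rewrite /Rintegral (@continuous_FTC2 _ _ F)//.
- exact: continuous_subspaceT.
- split; first by move=> x _; case: (dF x).
  + by apply: cvg_at_right_filter; exact: cF.
  + by apply: cvg_at_left_filter; exact: cF.
- by move=> x _; rewrite derive1E; case: (dF x).
Qed.

Lemma continuousM_sin {R : realType} (f : R -> R) (w : R) :
  continuous f -> continuous (fun x => f x * sin (w * x)).
Proof. by move=> cf x; apply: cvgM; [exact: cf|exact: continuous_sin_lin]. Qed.

Lemma fourier_sin_lin {R : realType} (p q : R) (f g : R -> R) (n : nat) :
  continuous f -> continuous g ->
  fourier_sin (fun x => p * f x + q * g x) n = p * fourier_sin f n + q * fourier_sin g n.
Proof.
move=> cf cg; rewrite /fourier_sin.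
have E x : (p * f x + q * g x) * sin (n%:R * pi * x) =
    p * (f x * sin (n%:R * pi * x)) + q * (g x * sin (n%:R * pi * x)) by ring.
under eq_Rintegral do rewrite E.
have If := continuous_integrable _ 0 1 (continuousM_sin f (n%:R * pi) cf).
have Ig := continuous_integrable _ 0 1 (continuousM_sin g (n%:R * pi) cg).
rewrite RintegralD//; last 2 first.
- by apply: continuous_integrable => x; apply: cvgMr; exact: (continuousM_sin _ _ cf).
- by apply: continuous_integrable => x; apply: cvgMr; exact: (continuousM_sin _ _ cg).
by rewrite !RintegralZl//; ring.
Qed.

(** Uniform in [n], because only |sin| <= 1 is used; the length [d] of the support will be R0 /
    L. *)
Lemma fourier_sin_bound {R : realType} (f : R -> R) (A d : R) (n : nat) :
  continuous f -> 0 <= d <= 1 ->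
  (forall x : R, 0 <= x <= 1 -> `|f x| <= A) ->
  (forall x : R, d < x <= 1 -> f x = 0) ->
  `|fourier_sin f n| <= 2 * A * d.
Proof.
move=> cf /andP[d0 d1] fA fd; rewrite /fourier_sin normrM ger0_norm// -mulrA ler_wpM2l//.
set F := fun x => f x * sin (n%:R * pi * x).
have cF : continuous F by exact: continuousM_sin.
have sub : [set` `[0, 1]] `&` [set` `[0, d]] = [set` `[0, d]] :> set R.
  rewrite setIidr// => x /=; rewrite !in_itv/= => /andP[-> xd].
  exact: le_trans xd d1.
have -> : \int[@lebesgue_measure R]_(x in `[0, 1]) F x =
    \int[@lebesgue_measure R]_(x in `[0, d]) F x.
  rewrite -sub Rintegral_mkcondr; apply: eq_Rintegral => x.
  rewrite inE/= in_itv/= => /andP[x0 x1]; rewrite patchE mem_setE in_itv/= x0/=.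
  by have [//|dx] := leP x d; rewrite /F fd ?dx ?mul0r.
apply: le_trans (le_normr_Rintegral _ _) _ => //; first exact: continuous_integrable.
have -> : A * d = \int[@lebesgue_measure R]_(x in `[0, d]) A.
  rewrite Rintegral_cst//= lebesgue_measure_itv/= lte_fin.
  by have [_|d0'] := ltP 0 d; rewrite ?oppr0 ?addr0//= -(le_anti (introT andP (conj d0 d0'))).
apply: le_Rintegral => //.
- by apply: continuous_integrable => x; apply: cvg_norm; exact: cF.
- by apply: continuous_integrable => x; exact: cvg_cst.
- move=> x /=; rewrite in_itv/= => /andP[x0 xd].
  rewrite /F normrM -[leRHS]mulr1 ler_pM//; first by apply: fA; rewrite x0 (le_trans xd).
  by rewrite ler_norml sin_geN1 sin_le1.
Qed.

Lemma sin_natpi {R : realType} (n : nat) : sin (n%:R * pi) = 0 :> R.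
Proof.
elim: n => [|n IH]; first by rewrite mul0r sin0.
by rewrite -natr1 mulrDl mul1r sinDpi IH oppr0.
Qed.

Lemma Rintegral01_cos {R : realType} (p : R) : p != 0 -> sin (p * pi) = 0 ->
  \int[@lebesgue_measure R]_(x in `[0, 1]) cos (p * pi * x) = 0.
Proof.
move=> p0 sp; have pp0 : p * pi != 0 by rewrite mulf_neq0// gt_eqF// pi_gt0.
have dF (x : R) : is_derive x 1 (fun x => (p * pi)^-1 * sin (p * pi * x)) (cos (p * pi * x)).
  have := @is_deriveZ _ _ _ _ (p * pi)^-1 x 1 _ (is_derive_sin_lin (p * pi) x).
  by rewrite /GRing.scale/= mulKf.
rewrite (Rintegral01_FTC _ _ (continuous_cos_lin _) dF).
by rewrite mulr1 sp !mulr0 sin0 mulr0 subrr.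
Qed.

Lemma fourier_sin_sin {R : realType} (m n : nat) :
  fourier_sin (fun x : R => sin (m%:R * pi * x)) n =
  ((n == m) && (0 < m)%N)%:R.
Proof.
rewrite /fourier_sin.
have [->|m0] := posnP m.
  under eq_Rintegral do rewrite !mul0r sin0 mul0r.
  by rewrite andbF Rintegral_cst//= mul0r mulr0.
have [->|n0] := posnP n.
  under eq_Rintegral do rewrite [0 * _]mul0r !mul0r sin0 mulr0.
  by rewrite eq_sym gtn_eqF// Rintegral_cst//= mul0r mulr0.
have E x : sin (m%:R * pi * x) * sin (n%:R * pi * x) =
    2^-1 * cos ((n%:R - m%:R) * pi * x) - 2^-1 * cos ((n%:R + m%:R) * pi * x) :> R.
  have -> : (n%:R - m%:R) * pi * x = n%:R * pi * x - m%:R * pi * x :> R by ring.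
  have -> : (n%:R + m%:R) * pi * x = n%:R * pi * x + m%:R * pi * x :> R by ring.
  by rewrite cosB cosD; field.
under eq_Rintegral do rewrite E.
have I p : (@lebesgue_measure R).-integrable `[0, 1] (EFin \o (fun x => cos (p * pi * x))).
  by apply: continuous_integrable; exact: continuous_cos_lin.
have I2 p : (@lebesgue_measure R).-integrable `[0, 1] (EFin \o (fun x => 2^-1 * cos (p * pi * x))).
  by apply: continuous_integrable => x; apply: cvgMr; exact: continuous_cos_lin.
rewrite RintegralB// !RintegralZl// [X in _ - _ * X]Rintegral01_cos; last 2 first.
- by rewrite gt_eqF// -natrD ltr0n addn_gt0 n0.
- by rewrite -natrD sin_natpi.
rewrite andbT; have [->|nm] := eqVneq n m.
  under eq_Rintegral do rewrite subrr !mul0r cos0.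
  by rewrite Rintegral_cst//= lebesgue_measure_itv/= lte_fin ltr01 oppr0 addr0/=; field.
rewrite Rintegral01_cos; first by rewrite !mulr0 subr0 mulr0.
- by rewrite subr_eq0 eqr_nat.
- by rewrite mulrBl sinB !sin_natpi !mul0r mulr0 subrr.
Qed.

(** [1 - x] is the datum 1 of [phi] minus the steady state [x]. At [n = 0] both sides vanish,
    division by 0 giving 0. *)
Lemma fourier_sin_onem {R : realType} (n : nat) :
  fourier_sin (fun x : R => 1 - x) n = 2 / (n%:R * pi).
Proof.
rewrite /fourier_sin; have [->|n0] := posnP n.
  under eq_Rintegral do rewrite !mul0r sin0 mulr0.
  by rewrite Rintegral_cst//= !mul0r invr0.
set w : R := n%:R * pi; have w0 : w != 0 by rewrite mulf_neq0// gt_eqF ?ltr0n ?pi_gt0.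
congr (_ * _).
pose F (x : R) := (- w^-1) * cos (w * x) + w^-1 * (x * cos (w * x)) + - (w^-1 ^+ 2) * sin (w * x).
have dF (x : R) : is_derive x 1 F ((1 - x) * sin (w * x)).
  have d1 := is_derive_cos_lin w x; have d2 := is_derive_sin_lin w x.
  have d3 := @is_deriveM _ _ id (fun x => cos (w * x)) x 1 _ _ (is_derive_id x 1) d1.
  have e1 := @is_deriveZ _ _ _ _ (- w^-1) _ _ _ d1.
  have e2 := @is_deriveZ _ _ _ _ (- (w^-1 ^+ 2)) _ _ _ d2.
  have e3 := @is_deriveZ _ _ _ _ w^-1 _ _ _ d3.
  have H := is_deriveD (is_deriveD e1 e3) e2.
  by apply: (is_derive_eq H); rewrite /GRing.scale/=; field.
have c1 : continuous (fun x : R => 1 - x).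
  by move=> x; apply: cvgB; [exact: cvg_cst|exact: cvg_id].
rewrite (Rintegral01_FTC _ _ (continuousM_sin _ w c1) dF).
by rewrite /F !mulr1 mulr0 sin_natpi !mul1r sin0 cos0; ring.
Qed.

Lemma heat_series_single {R : realType} (c y : R) (a : nat -> R) (m : nat) :
  (forall n, n != m -> a n = 0) ->
  heat_series c 0 a y = a m * expR (- (m%:R ^+ 2 * pi ^+ 2 * c)) * sin (m%:R * pi * y).
Proof.
move=> am; apply: lim_near_cst; first exact: norm_hausdorff.
near=> N; have mN : (m < N)%N by near: N; exact: nbhs_infty_gt.
rewrite /series/= big_mkord (bigD1 (Ordinal mN))//= big1 ?addr0.
  by rewrite /heat_term /heat_weight expr0 mulr1 mul0r addr0.
by move=> i im; rewrite /heat_term am ?mul0r.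
Unshelve. all: by end_near. Qed.

(** * Series representation of heat solutions *)

Lemma heat_sol_lin {R : realType} (p q : R) (z w : R -> R -> R) :
  heat_sol z -> heat_sol w -> heat_sol (fun x t => p * z x t + q * w x t).
Proof.
move=> [cz hz] [cw hw]; split.
  move=> x; apply: cvgD; apply: cvgMr; [exact: cz|exact: cw].
move=> t t0; have [g [a ga]] := hz t t0; have [h [b hb]] := hw t t0.
have D (f1 f2 : R -> R) (x d1 d2 : R) : is_derive x 1 f1 d1 -> is_derive x 1 f2 d2 ->
    is_derive x 1 (fun y => p * f1 y + q * f2 y) (p * d1 + q * d2).
  by move=> h1 h2; exact: (is_deriveD (is_deriveZ p h1) (is_deriveZ q h2)).
exists (fun x => p * g x + q * h x), (fun x => p * a x + q * b x) => x x01.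
have [? ? ?] := ga x x01; have [? ? ?] := hb x x01.
by split; exact: D.
Qed.

Lemma heat_sol_affine {R : realType} (p q : R) : heat_sol (fun x _ => p + q * x).
Proof.
split.
  apply: continuous_subspaceT => x; apply: cvgD; first exact: cvg_cst.
  by apply: cvgMr; exact: cvg_fst.
move=> t t0; exists (fun=> q), (fun=> 0) => x x01; split.
- have := is_deriveD (is_derive_cst p x 1) (is_derive_lin q x).
  by rewrite add0r.
- exact: is_derive_cst.
- exact: is_derive_cst.
Qed.

Lemma heat_sol_mode {R : realType} (m : nat) : heat_sol
  (fun x t : R => expR (- (m%:R ^+ 2 * pi ^+ 2 * t)) * sin (m%:R * pi * x)).
Proof.
split.
  apply: continuous_subspaceT => x; apply: cvgM.
    apply: continuous_comp; last exact: continuous_expR.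
    by apply: cvgN; apply: cvgMr; exact: cvg_snd.
  apply: (@continuous_comp _ _ _ (fun x : R * R => m%:R * pi * x.1) sin).
    by apply: cvgMr; exact: cvg_fst.
  exact: continuous_sin.
move=> t t0; set E := expR (- (m%:R ^+ 2 * pi ^+ 2 * t)); set w : R := m%:R * pi.
exists (fun x => E * (w * cos (w * x))), (fun x => E * (w * - (w * sin (w * x)))) => x x01.
split.
- exact: (is_deriveZ E (is_derive_sin_lin w x)).
- exact: (is_deriveZ E (is_deriveZ w (is_derive_cos_lin w x))).
have e1 : is_derive t 1 (fun s : R => expR (- (m%:R ^+ 2 * pi ^+ 2) * s))
    (expR (- (m%:R ^+ 2 * pi ^+ 2) * t) * - (m%:R ^+ 2 * pi ^+ 2)).
  apply: is_derive1_comp; exact: is_derive_lin.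
have e2 := is_deriveZ (sin (w * x)) e1.
have -> : (fun t0 => expR (- (m%:R ^+ 2 * pi ^+ 2 * t0)) * sin (w * x)) =
    sin (w * x) \*: (fun s : R => expR (- (m%:R ^+ 2 * pi ^+ 2) * s)).
  apply/funext => s.
  by rewrite -[RHS]/(sin (w * x) * expR (- (m%:R ^+ 2 * pi ^+ 2) * s)) mulNr mulrC.
by apply: (is_derive_eq e2); rewrite /GRing.scale/= /E /w mulNr; ring.
Qed.

Lemma fourier_sin_bounded {R : realType} (f : R -> R) : continuous f ->
  exists A, forall n, `|fourier_sin f n| <= A.
Proof.
move=> cf; have [||x _ fx] := @EVT_max _ (fun x => `|f x|) 0 1 => //.
  by apply: continuous_subspaceT => x; apply: cvg_norm; exact: cf.
exists (2 * `|f x| * 1) => n; apply: fourier_sin_bound => //.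
- by rewrite ler01 lexx.
- by move=> y /andP[y1 y1']; move: (lt_le_trans y1 y1'); rewrite ltxx.
Qed.

(** [Q] links time 0 to time [c]. The functions that start an exact solution agreeing with its
    series form a linear space containing the sines, so they are dense; a uniform error in the datum
    moves every coefficient, hence the series, by a comparable amount. *)
Lemma heat_sol_approx {R : realType} (c e : R) (f : R -> R) : 0 < c -> continuous f ->
  (forall y : R, y <= 0 \/ 1 <= y -> f y = 0) -> 0 < e ->
  exists Q, [/\ heat_sol Q, forall t : R, 0 <= t -> Q 0 t = 0 /\ Q 1 t = 0,
    forall x : R, 0 <= x <= 1 -> `|f x - Q x 0| <= e &
    forall y : R, `|heat_series c 0 (fourier_sin f) y - Q y c| <= e].
Proof.
move=> c0 cf f0 e0.
pose S (P : R -> R) := continuous P /\ exists Q, [/\ heat_sol Q,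
  forall t : R, 0 <= t -> Q 0 t = 0 /\ Q 1 t = 0,
  forall x : R, Q x 0 = P x &
  forall y : R, heat_series c 0 (fourier_sin P) y = Q y c].
pose W := limn (series (@heat_weight R c 0)).
have W0 : 0 <= W.
  apply: limr_ge; first exact: cvg_heat_weight.
  by apply: nearW => n; apply: sumr_ge0 => i _; exact: heat_weight_ge0.
(* An error [d] in the datum moves each coefficient by at most [2 * d] and the series by at most
   [2 * d * W]; both [d] and [2 * d * W] stay below [e]. *)
pose d := e / (2 * W + 1).
have W1 : 0 < 2 * W + 1 by rewrite ltr_wpDl// mulr_ge0.
have d0 : 0 < d by exact: divr_gt0.
have dE : d * (2 * W + 1) = e by rewrite /d divfK// gt_eqF.
have [|m|P [cP [Q [hQ Q0 QP QW]]] fP] := @sine_density R S _ _ f d cf f0 d0.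
- move=> a b g h [cg [Q [hQ Q0 Qg QW]]] [ch [Q' [hQ' Q0' Qh QW']]]; split.
    by move=> x; apply: cvgD; apply: cvgMr; [exact: cg|exact: ch].
  exists (fun x t => a * Q x t + b * Q' x t); split.
  + exact: heat_sol_lin.
  + by move=> t t0; have [-> ->] := Q0 t t0; have [-> ->] := Q0' t t0; rewrite !mulr0 addr0.
  + by move=> x; rewrite Qg Qh.
  + move=> y; have [A gA] := fourier_sin_bounded _ cg; have [B hB] := fourier_sin_bounded _ ch.
    rewrite -QW -QW' -(heat_series_lin c A B)//; congr (heat_series c 0 _ y).
    by apply/funext => n; exact: fourier_sin_lin.
- split; first exact: continuous_sin_lin.
  exists (fun x t : R => expR (- (m%:R ^+ 2 * pi ^+ 2 * t)) * sin (m%:R * pi * x)); split.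
  + exact: heat_sol_mode.
  + by move=> t t0; rewrite !mulr0 mulr1 sin0 sin_natpi !mulr0.
  + by move=> x; rewrite mulr0 oppr0 expR0 mul1r.
  + move=> y; rewrite (heat_series_single _ _ _ m); last first.
      by move=> n nm; rewrite fourier_sin_sin (negbTE nm).
    rewrite fourier_sin_sin eqxx; have [->|m0] := posnP m; last by rewrite mul1r.
    by rewrite !mul0r sin0 !mulr0.
exists Q; split => //.
- move=> x x01; rewrite QP (le_trans (fP x x01))// -dE ler_peMr ?(ltW d0)//.
  by rewrite lerDr mulr_ge0.
move=> y; rewrite -QW.
have [A fA] := fourier_sin_bounded _ cf; have [B PB] := fourier_sin_bounded _ cP.
have -> : heat_series c 0 (fourier_sin f) y - heat_series c 0 (fourier_sin P) y =
    heat_series c 0 (fourier_sin (fun x => 1 * f x + -1 * P x)) y.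
  transitivity (1 * heat_series c 0 (fourier_sin f) y + -1 * heat_series c 0 (fourier_sin P) y).
    by rewrite mul1r mulN1r.
  rewrite -(heat_series_lin c A B)//.
  by congr (heat_series c 0 _ y); apply/funext => n; rewrite fourier_sin_lin.
have [|_] := heat_series_bound c (2 * d * 1) 0 (fourier_sin (fun x => 1 * f x + -1 * P x)) y c0.
  move=> n; apply: fourier_sin_bound.
  - by move=> x; apply: cvgD; apply: cvgMr; [exact: cf|exact: cP].
  - by rewrite ler01 lexx.
  - by move=> x x01; rewrite mul1r mulN1r; exact: fP.
  - by move=> x /andP[x1 x1']; move: (lt_le_trans x1 x1'); rewrite ltxx.
move/le_trans; apply; rewrite -/W -dE mulr1 mulrDr mulr1.
by rewrite mulrA (mulrC d) lerDl ltW.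
Qed.

Lemma heat_sol_range {R : realType} (z : R -> R -> R) (lo hi : R) :
  heat_sol z ->
  (forall t : R, 0 <= t -> lo <= z 0 t <= hi /\ lo <= z 1 t <= hi) ->
  (forall x : R, 0 <= x <= 1 -> lo <= z x 0 <= hi) ->
  forall x t : R, 0 <= x <= 1 -> 0 <= t -> lo <= z x t <= hi.
Proof.
move=> hz zb zi x t x01 t0; apply/andP; split; last first.
  apply: (heat_sol_le _ _ hz) => // [s /zb[/andP[_ ?] /andP[_ ?]]//|y /zi/andP[]//].
rewrite -lerN2.
have hN := heat_sol_lin (-1) 0 _ _ hz hz.
have := heat_sol_le _ (- lo) hN; rewrite /= => H.
have := H _ _ x t x01 t0; rewrite mulN1r mul0r addr0; apply.
  by move=> s /zb[/andP[? _] /andP[? _]]; rewrite !mulN1r !mul0r !addr0 !lerN2.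
by move=> y /zi/andP[? _]; rewrite !mulN1r !mul0r !addr0 !lerN2.
Qed.

(** [z] and the approximating [Q] have nearby data, so the maximum principle keeps them close up to
    time [c], where [Q] is close to the series. *)
Lemma heat_sol_series {R : realType} (c : R) (z : R -> R -> R) (f : R -> R) (y : R) :
  0 < c -> continuous f ->
  (forall y : R, y <= 0 \/ 1 <= y -> f y = 0) ->
  heat_sol z -> (forall t : R, 0 <= t -> z 0 t = 0 /\ z 1 t = 0) ->
  (forall x : R, 0 <= x <= 1 -> z x 0 = f x) -> 0 <= y <= 1 ->
  z y c = heat_series c 0 (fourier_sin f) y.
Proof.
move=> c0 cf f0 hz zb zf y01; apply/eqP; rewrite -subr_eq0 -normr_le0.
apply/ler_addgt0Pr => e e0; rewrite add0r.
have [|Q [hQ Qb Qf Qs]] := heat_sol_approx c (e / 2) f c0 cf f0; first lra.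
have hD := heat_sol_lin 1 (-1) _ _ hz hQ.
have /andP[h1 h2] : - (e / 2) <= 1 * z y c + -1 * Q y c <= e / 2.
  apply: (heat_sol_range _ _ _ hD) => //; last exact: ltW.
    move=> t t0; have [-> ->] := Qb t t0; have [-> ->] := zb t t0.
    by rewrite !mulr0 addr0; split; apply/andP; split; lra.
  by move=> x x01; rewrite mul1r mulN1r zf// -ler_norml; exact: Qf.
by have := Qs y; rewrite !ler_norml => /andP[h3 h4]; apply/andP; split; lra.
Qed.

(** The maximum principle for the series itself, with no solution of datum [f] at hand; the affine
    part carries the boundary values. *)
Lemma heat_series_range {R : realType} (c p q lo hi : R) (f : R -> R) (y : R) :
  0 < c -> continuous f ->
  (forall y : R, y <= 0 \/ 1 <= y -> f y = 0) ->
  (forall x : R, 0 <= x <= 1 -> lo <= p + q * x + f x <= hi) ->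
  0 <= y <= 1 ->
  lo <= p + q * y + heat_series c 0 (fourier_sin f) y <= hi.
Proof.
move=> c0 cf f0 fb y01.
suff H e : 0 < e -> lo - e <= p + q * y + heat_series c 0 (fourier_sin f) y <= hi + e.
  by apply/andP; split; apply/ler_addgt0Pr => e /H /andP[? ?]; lra.
move=> e0.
have [|Q [hQ Qb Qf Qs]] := heat_sol_approx c (e / 2) f c0 cf f0; first lra.
have hD := heat_sol_lin 1 1 _ _ (heat_sol_affine p q) hQ.
have /andP[h1 h2] : lo - e / 2 <= 1 * (p + q * y) + 1 * Q y c <= hi + e / 2.
  apply: (heat_sol_range _ _ _ hD) => //; last exact: ltW.
    move=> t t0; have [-> ->] := Qb t t0.
    have := fb 0; have := fb 1; rewrite !lexx ler01 !f0; [|by left|by right].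
    by move=> /(_ isT)/andP[? ?] /(_ isT)/andP[? ?]; split; apply/andP; split; lra.
  move=> x x01; have := Qf x x01; rewrite ler_norml => /andP[? ?].
  by have /andP[? ?] := fb x x01; apply/andP; split; lra.
by have := Qs y; rewrite ler_norml => /andP[h3 h4]; apply/andP; split; lra.
Qed.

(** * Bounds on jets relative to a set *)

Lemma diffq_cvgP {R : realType} (A : set R) (f : R -> R) (x a : R) :
  diffq f x @ within A x^' --> a <->
  forall e, 0 < e -> exists2 d, 0 < d & forall y, A y -> `|y - x| < d ->
    `|f y - f x - a * (y - x)| <= e * `|y - x|.
Proof.
have E y : y != x -> `|a - diffq f x y| * `|y - x| = `|f y - f x - a * (y - x)|.
  by rewrite -subr_eq0 => yx; rewrite -normrM mulrBl /diffq divfK// distrC.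
split=> [/cvgrPdist_le df e e0|H].
  have /nbhs_ballP[d /= d0 hd] := df e e0.
  exists d => // y Ay yd; have [->|yx] := eqVneq y x.
    by rewrite !subrr mulr0 subrr !normr0 mulr0.
  rewrite -E// ler_pM2r ?normr_gt0 ?subr_eq0//; apply: hd => //.
  by rewrite /ball/= distrC.
apply/cvgrPdist_le => e /H[d d0 hd].
apply/nbhs_ballP; exists d => //= y; rewrite /ball/= distrC => yd yx Ay.
by rewrite -(ler_pM2r (x:=`|y - x|)) ?normr_gt0 ?subr_eq0// E// hd.
Qed.

Lemma is_derive_diffq {R : realType} (A : set R) (f : R -> R) (x a : R) :
  is_derive x 1 f a -> diffq f x @ within A x^' --> a.
Proof.
move=> /is_derive1_dist df; apply/diffq_cvgP => e /df[d d0 hd].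
by exists d => // y _ /hd; rewrite subrKC.
Qed.

Lemma eq_diffq {R : realType} (A : set R) (f g : R -> R) (x a : R) :
  A x -> (forall y, A y -> f y = g y) ->
  diffq f x @ within A x^' --> a -> diffq g x @ within A x^' --> a.
Proof.
move=> Ax fg /diffq_cvgP df; apply/diffq_cvgP => e /df[d d0 hd].
by exists d => // y Ay; rewrite -!fg//; exact: hd.
Qed.

Lemma diffq_continuous {R : realType} (A : set R) (f : R -> R) (x a : R) :
  diffq f x @ within A x^' --> a -> f @ within A (nbhs x) --> f x.
Proof.
move=> /diffq_cvgP df; have [d d0 hd] := df 1 ltr01.
have K0 : 0 < `|a| + 1 by rewrite ltr_wpDl.
apply/cvgrPdist_le => e e0; apply/nbhs_ballP.
exists (Num.min d (e / (`|a| + 1))) => /=; first by rewrite lt_min d0 divr_gt0.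
move=> y; rewrite /ball/= distrC lt_min => /andP[yd /ltW ye] Ay.
have h := hd y Ay yd; rewrite distrC -(subrK (a * (y - x)) (f y - f x)).
apply: le_trans (ler_normD _ _) _; apply: le_trans (lerD h (lexx _)) _.
move: ye; rewrite ler_pdivlMr// => ye; apply: le_trans ye.
by rewrite normrM -mulrDl mulrC (addrC 1).
Qed.

Lemma cvg_within_dnbhs {R : realType} (A : set R) (f : R -> R) (x a : R) :
  f @ within A (nbhs x) --> a -> f @ within A x^' --> a.
Proof.
move=> fa P /fa H; change (nbhs x [set y | y != x -> A y -> P (f y)]).
have {}H : nbhs x [set y | A y -> P (f y)] := H.
by apply: filterS H => y h _; exact: h.
Qed.

Lemma diffqM {R : realType} (A : set R) (f g : R -> R) (x a b : R) :
  diffq f x @ within A x^' --> a -> diffq g x @ within A x^' --> b ->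
  diffq (fun y => f y * g y) x @ within A x^' --> a * g x + f x * b.
Proof.
move=> df dg; have cg : g @ within A x^' --> g x.
  exact/cvg_within_dnbhs/(diffq_continuous _ _ _ _ dg).
have -> : diffq (fun y => f y * g y) x = (fun y => diffq f x y * g y + f x * diffq g x y).
  by apply/funext => y; rewrite /diffq; ring.
by apply: cvgD; [exact: cvgM|exact: cvgMr].
Qed.

Lemma diffqD {R : realType} (A : set R) (f g : R -> R) (x a b : R) :
  diffq f x @ within A x^' --> a -> diffq g x @ within A x^' --> b ->
  diffq (fun y => f y + g y) x @ within A x^' --> a + b.
Proof.
move=> df dg.
have -> : diffq (fun y => f y + g y) x = (fun y => diffq f x y + diffq g x y).
  by apply/funext => y; rewrite /diffq; ring.
exact: cvgD.
Qed.

Lemma diffqV {R : realType} (A : set R) (f : R -> R) (x a : R) :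
  A x -> (forall y, A y -> f y != 0) ->
  diffq f x @ within A x^' --> a ->
  diffq (fun y => (f y)^-1) x @ within A x^' --> - a * ((f x)^-1 * (f x)^-1).
Proof.
move=> Ax f0 df; have cf : f @ within A x^' --> f x.
  exact/cvg_within_dnbhs/(diffq_continuous _ _ _ _ df).
have H : (fun y => - diffq f x y * ((f y)^-1 * (f x)^-1)) @ within A x^' -->
    - a * ((f x)^-1 * (f x)^-1).
  apply: cvgM; first exact: cvgN.
  by apply: cvgMl; apply: cvgV => //; exact: f0.
apply: cvg_trans H; apply: near_eq_cvg.
apply: filterS (withinT _ _) => y Ay; rewrite /diffq; set D := (y - x)^-1.
have ? := f0 _ Ax; have ? := f0 _ Ay.
by field; apply/andP.
Qed.

(** Derivatives are existential witnesses rather than values of [derive_in], so sums, products and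
    inverses follow by induction from the rules for difference quotients. One [B] bounds all orders,
    and only values on [A] matter. *)
Fixpoint jet_bounded {R : realType} (A : set R) (k : nat) (f : R -> R) (B : R) : Prop :=
  (forall x, A x -> `|f x| <= B) /\
  if k is k'.+1 then
    exists2 g, forall x, A x -> diffq f x @ within A x^' --> g x & jet_bounded A k' g B
  else {within A, continuous f}.

Section jets.
Local Set Implicit Arguments.
Local Unset Strict Implicit.

Context {R : realType} (A : set R).
Implicit Types (f g : R -> R) (B : R) (k : nat).

Lemma jet_bounded_norm k f B x : jet_bounded A k f B -> A x -> `|f x| <= B.
Proof. by case: k => [|k] [+ _]; apply. Qed.

Lemma eq_jet_bounded k f g B : (forall x, A x -> f x = g x) ->
  jet_bounded A k f B -> jet_bounded A k g B.
Proof.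
case: k => [|k] fg [fB H]; (split; first by move=> x Ax; rewrite -fg//; exact: fB).
  by apply: subspace_eq_continuous H => x; rewrite inE => /fg.
by case: H => f' df f'B; exists f' => // x Ax; exact: eq_diffq fg (df x Ax).
Qed.

Lemma jet_bounded_le k f B B' : B <= B' -> jet_bounded A k f B -> jet_bounded A k f B'.
Proof.
move=> BB'; elim: k f => [|k IH] f [fB H]; (split; first by move=> x /fB/le_trans; exact).
  by [].
by case: H => f' df /IH; exists f'.
Qed.

Lemma jet_bounded_continuous k f B : jet_bounded A k f B -> {within A, continuous f}.
Proof.
case: k => [|k] [_ //]; case=> f' df _; apply/subspace_continuousP => x /df.
exact: diffq_continuous.
Qed.

Lemma jet_boundedS k f B : jet_bounded A k.+1 f B -> jet_bounded A k f B.
Proof.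
elim: k f => [|k IH] f h; first by split; [by case: h|exact: jet_bounded_continuous h].
by case: h => fB [g dg gB]; split => //; exists g => //; exact: IH.
Qed.

Lemma jet_boundedD k f g B B' : jet_bounded A k f B -> jet_bounded A k g B' ->
  jet_bounded A k (fun x => f x + g x) (B + B').
Proof.
have sumB k0 f0 g0 : jet_bounded A k0 f0 B -> jet_bounded A k0 g0 B' ->
    forall x, A x -> `|f0 x + g0 x| <= B + B'.
  move=> hf hg x Ax; apply: le_trans (ler_normD _ _) _.
  by rewrite lerD ?(jet_bounded_norm hf) ?(jet_bounded_norm hg).
elim: k f g => [|k IH] f g hf hg.
  split; first exact: sumB hf hg.
  case: hf => _ cf; case: hg => _ cg x.
  by apply: cvgD; [exact: cf|exact: cg].
split; first exact: sumB hf hg.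
case: hf => _ [f' df f'B]; case: hg => _ [g' dg g'B].
exists (fun x => f' x + g' x); last exact: IH.
by move=> x Ax; apply: diffqD; [exact: df|exact: dg].
Qed.

(** The Leibniz rule at most doubles the number of products at each order, whence [2 ^+ k]. *)
Lemma jet_boundedM k f g B B' : jet_bounded A k f B -> jet_bounded A k g B' ->
  jet_bounded A k (fun x => f x * g x) (2 ^+ k * (B * B')).
Proof.
have fg k0 f0 g0 x : jet_bounded A k0 f0 B -> jet_bounded A k0 g0 B' -> A x ->
    `|f0 x * g0 x| <= 2 ^+ k0 * (B * B').
  move=> /jet_bounded_norm hf /jet_bounded_norm hg Ax.
  have fB := hf _ Ax; have gB := hg _ Ax.
  rewrite normrM -[leLHS]mul1r ler_pM ?mulr_ge0// ?ler_pM// exprn_ege1//.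
  by rewrite ler1n.
elim: k f g => [|k IH] f g hf hg.
  split; first by move=> x; exact: fg hf hg.
  case: hf => _ cf; case: hg => _ cg x.
  by apply: cvgM; [exact: cf|exact: cg].
split; first by move=> x; exact: fg hf hg.
have {}hf' := jet_boundedS hf; have {}hg' := jet_boundedS hg.
case: hf => _ [f' df f'B]; case: hg => _ [g' dg g'B].
exists (fun x => f' x * g x + f x * g' x).
  by move=> x Ax; apply: diffqM; [exact: df|exact: dg].
rewrite exprS -mulrA (_ : 2 * _ = 2 ^+ k * (B * B') + 2 ^+ k * (B * B')); last by ring.
by apply: jet_boundedD; apply: IH.
Qed.

Lemma jet_bounded_cst k (a : R) : jet_bounded A k (fun=> a) `|a|.
Proof.
(* The derivative of a constant is 0, so the induction must also carry the zero function with the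
   same bound. *)
suff H b : jet_bounded A k (fun=> b) `|b| /\ jet_bounded A k (fun=> 0) `|b| by case: (H a).
have d0 (e : R) x : diffq (fun=> e) x @ within A x^' --> (0 : R).
  by apply: is_derive_diffq; exact: is_derive_cst.
elim: k => [|k [_ IH]].
  by split; split=> [x _|]; rewrite ?normr0//; apply: continuous_subspaceT => x; exact: cvg_cst.
by split; split=> [x _|]; rewrite ?normr0//; exists (fun=> 0).
Qed.

(** [B'] precedes [f], as uniformity in [L] requires. The derivative of the inverse is [- f'] times
    two inverses, already bounded at order [k]. *)
Lemma jet_boundedV k m B : 0 < m -> exists B', forall f, (forall x, A x -> m <= f x) ->
  jet_bounded A k f B -> jet_bounded A k (fun x => (f x)^-1) B'.
Proof.
move=> m0; have fV f x : m <= f x -> `|(f x)^-1| <= m^-1.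
  move=> mf; have f0 := lt_le_trans m0 mf.
  by rewrite ger0_norm ?invr_ge0 ?(ltW f0)// lef_pV2.
elim: k => [|k [B' IH]].
  exists m^-1 => f mf [_ cf]; split; first by move=> x /mf/fV.
  apply/subspace_continuousP => x Ax; apply: cvgV.
    by rewrite gt_eqF// (lt_le_trans m0)// mf.
  by move/subspace_continuousP : cf; apply.
pose C := 2 ^+ k * (2 ^+ k * (1 * B) * (2 ^+ k * (B' * B'))).
exists (Num.max m^-1 C) => f mf hf; split.
  by move=> x /mf/fV/le_trans; apply; rewrite le_max lexx.
have fk := jet_boundedS hf; case: hf => _ [f' df f'B].
exists (fun x => - f' x * ((f x)^-1 * (f x)^-1)).
  move=> x Ax; apply: diffqV => //; last exact: df.
  by move=> y Ay; rewrite gt_eqF// (lt_le_trans m0)// mf.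
apply: (@jet_bounded_le _ _ C); first by rewrite le_max lexx orbT.
have h1 := jet_bounded_cst k (-1 : R); rewrite normrN1 in h1.
have h := jet_boundedM (jet_boundedM h1 f'B) (jet_boundedM (IH f mf fk) (IH f mf fk)).
by apply: eq_jet_bounded h => x Ax; rewrite mulN1r.
Qed.

(** Makes limits along [A] unique, which identifies the witnesses with [derive_in]. *)
Hypothesis A_proper : forall x, A x -> ProperFilter (within A x^').

Lemma diffq_derive_in f (x a : R) : A x ->
  diffq f x @ within A x^' --> a -> derivable_in A f x /\ derive_in A f x = a.
Proof.
move=> Ax df; have PF := A_proper Ax.
by split; [exact: cvgP df|apply: cvg_lim df; exact: norm_hausdorff].
Qed.

Lemma jet_bounded_derive k f B : jet_bounded A k f B ->
  is_Ck A k f /\ forall j x, (j <= k)%N -> A x -> `|derive_in_n A j f x| <= B.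
Proof.
elim: k f => [|k IH] f hf.
  split; last by move=> [|//] x _ Ax; exact: jet_bounded_norm hf Ax.
  by split=> [//|[|//] _]; case: hf.
have cf := jet_bounded_continuous hf.
case: (hf) => fB [g dg /(@eq_jet_bounded _ _ (derive_in A f)) gB].
have [|[D C] N] := IH (derive_in A f).
  by apply: gB => x Ax; have [_ ->] := diffq_derive_in Ax (dg x Ax).
split; [split|].
- move=> [|j] x jk Ax; first by have [] := diffq_derive_in Ax (dg x Ax).
  by rewrite /derive_in_n iterSr; exact: D.
- by move=> [//|j] jk; rewrite /derive_in_n iterSr; exact: C.
- by move=> [|j] x jk Ax; [exact: fB|rewrite /derive_in_n iterSr; exact: N].
Qed.

Lemma Ck_norm_le k f B : jet_bounded A k f B ->
  (Ck_norm A k f <= (k.+1%:R * B)%:E)%E.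
Proof.
move=> /jet_bounded_derive[_ N].
have -> : (k.+1%:R * B)%:E = (\sum_(j < k.+1) B%:E)%E.
  by rewrite sumEFin sumr_const card_ord mulr_natl.
apply: lee_sum => j _; apply: ge_ereal_sup => _ [x Ax <-].
by rewrite lee_fin N// -ltnS.
Qed.

End jets.

Lemma within_itv_dnbhs_proper {R : realType} (r x : R) : 0 < r -> `[0, r]%classic x ->
  ProperFilter (within `[0, r] x^').
Proof.
move=> r0 /=; rewrite in_itv/= => /andP[x0 xr].
apply: Build_ProperFilter_ex => P /nbhs_ballP[e /= e0 he].
have m0 : 0 < Num.min e r / 2 by rewrite divr_gt0// lt_min e0.
have [me mr] : Num.min e r <= e /\ Num.min e r <= r by split; rewrite ge_min lexx ?orbT.
set m := Num.min e r in m0 me mr.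
have [xr2|xr2] := leP x (r / 2).
  exists (x + m / 2); apply: he => /=.
  - by rewrite /ball/= opprD addrA subrr sub0r normrN gtr0_norm//; lra.
  - by rewrite -subr_eq0 addrC addKr gt_eqF.
  - by rewrite in_itv/=; apply/andP; split; lra.
exists (x - m / 2); apply: he => /=.
- by rewrite /ball/= opprB addrC subrK gtr0_norm//; lra.
- by rewrite -subr_eq0 addrC addKr lt_eqF// oppr_lt0.
- by rewrite in_itv/=; apply/andP; split; lra.
Qed.

(** * Convergence to the profile *)

Section initial_datum.
Context {R : realType} (R0 : R) (u0 : R -> R).
Hypotheses (R0_gt0 : 0 < R0) (u0_L1 : L1_supported R0 u0).
Let mu := @lebesgue_measure R.

Lemma norm_Rintegral_le_L1 (x : R) :
  `|\int[mu]_(z in `]0, x]) u0 z| <= L1_norm u0.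
Proof.
have [iu _] := u0_L1; have sub : `]0, x] `<=` `]0, +oo[.
  by move=> z /=; rewrite !in_itv/= andbT => /andP[].
apply: le_trans (le_normr_Rintegral _ _) _ => //; first exact: integrableS iu.
have iN : mu.-integrable `]0, +oo[ (EFin \o (fun z => `|u0 z|)).
  exact: (integrable_abse iu).
rewrite /L1_norm /Rintegral fine_le//.
- by apply: integrable_fin_num => //; exact: integrableS iN.
- exact: integrable_fin_num.
- apply: ge0_subset_integral => //; first by case/integrableP : iN.
Qed.

Lemma norm_mass_le : `|mass u0| <= L1_norm u0.
Proof. by have [iu _] := u0_L1; exact: le_normr_Rintegral. Qed.

Lemma mass_itv (x : R) : R0 <= x -> \int[mu]_(z in `]0, x]) u0 z = mass u0.
Proof.
move=> R0x; have [iu ae0] := u0_L1; have x0 : 0 < x by exact: lt_le_trans R0x.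
have U : [set` `]0, +oo[] = [set` `]0, x]] `|` [set` `]x, +oo[] :> set R.
  by rewrite -itv_bndbnd_setU ?bnd_simp// ltW.
have sub : `]x, +oo[ `<=` `]0, +oo[.
  by move=> z /=; rewrite !in_itv/= !andbT; exact: lt_trans.
have iux : mu.-integrable `]x, +oo[ (EFin \o u0) by exact: integrableS iu.
rewrite /mass U Rintegral_setU//.
- suff -> : \int[mu]_(z in `]x, +oo[) u0 z = 0 by rewrite addr0.
  rewrite /Rintegral (ae_eq_integral (cst 0%E))//; first by rewrite integral0.
    by case/integrableP : iux.
  case: ae0 => N [mN N0 subN]; exists N; split => //; apply: subset_trans subN => z /=.
  apply: contra_not => hz; rewrite in_itv/= andbT => xz.
  by rewrite hz// (le_lt_trans R0x).
- by rewrite -U.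
- apply/disj_setPLR => z /=; rewrite !in_itv/= => /andP[_ zx].
  by rewrite andbT ltNge zx.
Qed.

Lemma w_init_bounds (x : R) : expR (- L1_norm u0) <= w_init u0 x <= expR (L1_norm u0).
Proof. by rewrite /w_init !ler_expR -ler_norml norm_Rintegral_le_L1. Qed.

Lemma expR_mass_bounds : expR (- L1_norm u0) <= expR (mass u0) <= expR (L1_norm u0).
Proof. by rewrite !ler_expR -ler_norml norm_mass_le. Qed.

Lemma L1_norm_ge0 : 0 <= L1_norm u0.
Proof. exact: le_trans (normr_ge0 _) norm_mass_le. Qed.

End initial_datum.

(** * Extension from the unit interval, and the step datum *)

Lemma within_continuous_comp_fun {S T U : topologicalType} (A : set S) (B : set T)
    (F : T -> U) (h : S -> T) :
  {within B, continuous F} -> continuous h -> (forall p, A p -> B (h p)) ->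
  {within A, continuous (fun p => F (h p))}.
Proof.
move=> /subspace_continuousP cF ch AB; apply/subspace_continuousP => p Ap P FP.
have H : nbhs (h p) [set q | B q -> P (F q)] := cF _ (AB _ Ap) P FP.
have {}H : nbhs p [set q | B (h q) -> P (F (h q))] := ch p _ H.
by apply: filterS H => q h1 Aq; apply: h1; exact: AB.
Qed.

Lemma continuous_minr {R : realType} (f g : R -> R) :
  continuous f -> continuous g -> continuous (fun x => Num.min (f x) (g x)).
Proof. by move=> cf cg x; have := continuous_min (cf x) (cg x); exact. Qed.

Lemma continuous_maxr {R : realType} (f g : R -> R) :
  continuous f -> continuous g -> continuous (fun x => Num.max (f x) (g x)).
Proof. by move=> cf cg x; have := continuous_max (cf x) (cg x); exact. Qed.

(** Extends data on [0, 1] continuously to the line, as the coefficient lemmas ask for global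
    continuity. *)
Definition clamp01 {R : realType} (y : R) : R := Num.max 0 (Num.min y 1).

Lemma clamp01_id {R : realType} (y : R) : 0 <= y <= 1 -> clamp01 y = y.
Proof. by move=> /andP[y0 y1]; rewrite /clamp01 min_l// max_r. Qed.

Lemma clamp01_itv {R : realType} (y : R) : 0 <= clamp01 y <= 1.
Proof. by rewrite /clamp01 le_max lexx/= ge_max ler01 ge_min lexx orbT. Qed.

Lemma clamp01_le0 {R : realType} (y : R) : y <= 0 -> clamp01 y = 0.
Proof. by move=> y0; rewrite /clamp01 max_l// ge_min y0. Qed.

Lemma clamp01_ge1 {R : realType} (y : R) : 1 <= y -> clamp01 y = 1.
Proof. by move=> y0; rewrite /clamp01 min_r// max_r. Qed.

Lemma continuous_clamp01 {R : realType} : continuous (@clamp01 R).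
Proof.
apply: continuous_maxr; first by move=> x; exact: cvg_cst.
by apply: continuous_minr => x; [exact: cvg_id|exact: cvg_cst].
Qed.

Definition step_coef {R : realType} (n : nat) : R := 2 / (n%:R * pi).

Lemma norm_step_coef {R : realType} (n : nat) : `|step_coef n : R| <= 1.
Proof.
rewrite /step_coef; case: n => [|n]; first by rewrite mul0r invr0 mulr0 normr0.
have p2 := @pi_ge2 R; rewrite ger0_norm ?divr_ge0 ?mulr_ge0 ?pi_ge0//.
rewrite ler_pdivrMr ?mul1r ?mulr_gt0 ?pi_gt0// (le_trans p2)//.
by rewrite ler_peMl ?pi_ge0// ler1n.
Qed.

(* [2 q / (n pi)] are the sine coefficients of [q (1 - x)]. *)
Lemma fourier_sin_near_step {R : realType} (f : R -> R) (q A d : R) (n : nat) :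
  continuous f -> 0 <= d <= 1 ->
  (forall x : R, 0 <= x <= 1 -> `|f x - q * (1 - x)| <= A) ->
  (forall x : R, d < x <= 1 -> f x = q * (1 - x)) ->
  `|fourier_sin f n - q * step_coef n| <= 2 * A * d.
Proof.
move=> cf d01 fA fd; rewrite /step_coef -fourier_sin_onem.
have c1 : continuous (fun x : R => 1 - x).
  by move=> x; apply: cvgB; [exact: cvg_cst|exact: cvg_id].
have -> : fourier_sin f n - q * fourier_sin (fun x => 1 - x) n =
    fourier_sin (fun x => 1 * f x + (- q) * (1 - x)) n.
  by rewrite fourier_sin_lin// mul1r mulNr.
apply: fourier_sin_bound => // [x|x x01|x /fd ->].
- by apply: cvgD; apply: cvgMr; [exact: cf|exact: c1].
- by rewrite mul1r mulNr fA.
- by rewrite mul1r mulNr subrr.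
Qed.

(** The datum of [phi] is a step, out of reach of [heat_series_range]; ramps of width [d] are within
    reach, and their coefficients differ from those of the step by at most [2 * d]. *)
Lemma phi_range {R : realType} (c y : R) : 0 < c -> 0 <= y <= 1 ->
  0 <= y + heat_series c 0 step_coef y <= 1.
Proof.
move=> c0 y01; pose W := limn (series (@heat_weight R c 0)).
have W0 : 0 <= W.
  apply: limr_ge; first exact: cvg_heat_weight.
  by apply: nearW => n; apply: sumr_ge0 => i _; exact: heat_weight_ge0.
suff H e : 0 < e -> 0 - e <= y + heat_series c 0 step_coef y <= 1 + e.
  by apply/andP; split; apply/ler_addgt0Pr => e /H /andP[? ?]; lra.
move=> e0; have W1 : 0 < 2 * W + 1 by rewrite ltr_wpDl// mulr_ge0.
pose d := Num.min 1 (e / (2 * W + 1)).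
have d0 : 0 < d by rewrite lt_min ltr01 divr_gt0.
have d1 : d <= 1 by rewrite ge_min lexx.
have de : d * (2 * W + 1) <= e by rewrite -ler_pdivlMr// ge_min lexx orbT.
(* The ramp minus the steady state, extended by 0 outside [0, 1]. *)
pose f (x : R) := Num.min (clamp01 x / d) 1 - clamp01 x.
have cf : continuous f.
  move=> x; apply: cvgB; last exact: continuous_clamp01.
  apply: (continuous_minr (fun x => clamp01 x / d) (fun=> 1)) => z; last exact: cvg_cst.
  by apply: cvgMl; exact: continuous_clamp01.
have f0 (x : R) : x <= 0 \/ 1 <= x -> f x = 0.
  rewrite /f => -[/clamp01_le0 ->|/clamp01_ge1 ->].
    by rewrite mul0r min_l// subr0.
  by rewrite min_r ?subrr// ler_pdivlMr// mul1r.
have fE (x : R) : 0 <= x <= 1 -> f x = Num.min (x / d) 1 - x.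
  by move=> x01; rewrite /f clamp01_id.
have fm (x : R) : 0 <= x <= 1 -> 0 <= Num.min (x / d) 1 <= 1.
  by move=> /andP[x0 _]; rewrite le_min divr_ge0 ?(ltW d0)//= ler01 ge_min lexx orbT.
have /andP[h1 h2] : 0 <= 0 + 1 * y + heat_series c 0 (fourier_sin f) y <= 1.
  by apply: heat_series_range => // x x01; rewrite fE// add0r mul1r subrKC fm.
have ab n : `|fourier_sin f n - step_coef n| <= 2 * d.
  rewrite -[step_coef n]mul1r -[2 * d]/(2 * d) -[2]mulr1.
  apply: fourier_sin_near_step => //; first by rewrite (ltW d0).
    move=> x x01; rewrite fE//; have /andP[? ?] := fm x x01.
    by rewrite ler_norml; apply/andP; split; lra.
  move=> x /andP[dx x1]; have x0 := lt_trans d0 dx.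
  by rewrite fE ?(ltW x0)// min_r ?mul1r// ler_pdivlMr// mul1r ltW.
have [A fA] := fourier_sin_bounded _ cf.
have E : heat_series c 0 (fun n => 1 * fourier_sin f n + -1 * step_coef n) y =
    heat_series c 0 (fourier_sin f) y - heat_series c 0 step_coef y.
  rewrite (heat_series_lin c A 1)//; last exact: norm_step_coef.
  by rewrite mul1r mulN1r.
have [|_] := heat_series_bound c (2 * d) 0 (fun n => 1 * fourier_sin f n + -1 * step_coef n) y c0.
  by move=> n; rewrite mul1r mulN1r.
rewrite E -/W ler_norml => /andP[? ?].
by apply/andP; split; nra.
Qed.

(** * Series form of the potential, of its logarithmic derivative and of the profile *)

Lemma hopf_cole_potential_heat_sol {R : realType} (u0 : R -> R) (L : R) (w : R -> R -> R) :
  0 < L -> hopf_cole_potential u0 L w ->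
  heat_sol (fun y tau => w (L * y) (L ^+ 2 * tau)).
Proof.
move=> L0 hw; have L20 : 0 < L ^+ 2 by rewrite exprn_gt0.
split.
  have ch : continuous (fun p : R * R => (L * p.1, L ^+ 2 * p.2)).
    move=> p; have h1 : (fun p : R * R => L * p.1) @ p --> L * p.1.
      by apply: cvgMr; exact: cvg_fst.
    have h2 : (fun p : R * R => L ^+ 2 * p.2) @ p --> L ^+ 2 * p.2.
      by apply: cvgMr; exact: cvg_snd.
    exact: cvg_pair h1 h2.
  apply: (within_continuous_comp_fun _ _ _ _ (hcp_continuous hw) ch).
  move=> [y t] [/=]; rewrite !in_itv/= !andbT => /andP[y0 y1] t0.
  by rewrite !mulr_ge0 ?(ltW L0) ?(ltW L20) ?ger_pMr.
move=> t t0; have t20 : 0 < L ^+ 2 * t by exact: mulr_gt0.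
pose v := w ^~ (L ^+ 2 * t).
exists (fun y => L * derive1 v (L * y)), (fun y => L ^+ 2 * derive1 (derive1 v) (L * y)).
move=> y /andP[y0 y1]; have Ly : 0 < L * y < L by rewrite mulr_gt0//= gtr_pMr.
have D (f : R -> R) (x z l : R) : derivable f (l * z) 1 ->
    is_derive z 1 (fun z => f (l * z)) (l * derive1 f (l * z)).
  move=> df; rewrite mulrC; apply: is_derive1_comp; last exact: is_derive_lin.
  by apply: DeriveDef => //; rewrite derive1E.
split.
- exact/D/(hcp_derivable_x hw).
- have := is_deriveZ L (D _ 0 y L (hcp_derivable_xx hw Ly t20)).
  by move=> H; apply: (is_derive_eq H); rewrite /GRing.scale/= mulrA -expr2.
- by rewrite -[derive1 (derive1 v)]/(derive1n 2 v) -(hcp_heat hw)//; exact/D/(hcp_derivable_t hw).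
Qed.

(** The denominator of [Phi] for [q = expR M - 1]: it is 1 + q phi(y, c), the value at time [c] of
    the solution with datum e^M. *)
Definition step_profile {R : realType} (c q y : R) : R :=
  1 + q * (y + heat_series c 0 step_coef y).

Definition dstep_profile {R : realType} (c q y : R) : R :=
  q * (1 + heat_series c 1 step_coef y).

Lemma is_derive_step_profile {R : realType} (c q y : R) : 0 < c ->
  is_derive y 1 (step_profile c q) (dstep_profile c q y).
Proof.
move=> c0; have d1 := is_derive_heat_series c 1 0 step_coef y c0 norm_step_coef.
have H := is_deriveD (is_derive_cst (1 : R) y 1) (is_deriveZ q (is_deriveD (is_derive_id y 1) d1)).
by apply: (is_derive_eq H); rewrite add0r.
Qed.

Lemma hopf_cole_potential_series {R : realType} (R0 c L : R) (u0 : R -> R)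
    (w : R -> R -> R) :
  0 < R0 -> 0 < c -> R0 <= L -> L1_supported R0 u0 -> hopf_cole_potential u0 L w ->
  exists d : nat -> R, (forall n, `|d n| <= 2 * expR (L1_norm u0) * (R0 / L)) /\
    forall y : R, 0 <= y <= 1 ->
      expR (- L1_norm u0) <= w (L * y) (c * L ^+ 2) /\
      w (L * y) (c * L ^+ 2) =
        step_profile c (expR (mass u0) - 1) y + heat_series c 0 d y.
Proof.
move=> R00 c0 R0L u0L hw; have L0 : 0 < L := lt_le_trans R00 R0L.
set q := expR (mass u0) - 1; pose z y tau := w (L * y) (L ^+ 2 * tau).
have hz : heat_sol z by exact: hopf_cole_potential_heat_sol hw.
have Ly (y : R) : 0 <= y <= 1 -> 0 <= L * y <= L.
  by move=> /andP[y0 y1]; rewrite mulr_ge0 ?(ltW L0)//= ger_pMr.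
have zi (y : R) : 0 <= y <= 1 -> z y 0 = w_init u0 (L * y).
  by move=> y01; rewrite /z mulr0 (hcp_init hw)// Ly.
have zb (t : R) : 0 <= t -> z 0 t = 1 /\ z 1 t = 1 + q.
  move=> t0; rewrite /z mulr0 mulr1 (hcp_left hw) ?(hcp_right hw) ?mulr_ge0 ?exprn_ge0 ?(ltW L0)//.
  by rewrite /q subrKC.
(* The affine function matches both boundary values, so [f] vanishes at 0 and 1. *)
pose f (y : R) := z (clamp01 y) 0 - (1 + q * clamp01 y).
have cf : continuous f.
  move=> y; apply: cvgB; last first.
    by apply: cvgD; [exact: cvg_cst|apply: cvgMr; exact: continuous_clamp01].
  have ch : continuous (fun y : R => (clamp01 y, 0 : R)).
    by move=> x; exact: cvg_pair (continuous_clamp01 x) (cvg_cst 0).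
  have H := within_continuous_comp_fun [set: R] _ _ _ hz.1 ch.
  apply: ((continuous_subspace_setT _).2 (H _)) => p _.
  by split; rewrite /= in_itv/= ?lexx//; exact: clamp01_itv.
have f0 (y : R) : y <= 0 \/ 1 <= y -> f y = 0.
  have [z0 z1] := zb 0 (lexx _); rewrite /f => -[/clamp01_le0 ->|/clamp01_ge1 ->].
    by rewrite z0 mulr0 addr0 subrr.
  by rewrite z1 mulr1 subrr.
have fE (y : R) : 0 <= y <= 1 -> f y = z y 0 - (1 + q * y).
  by move=> y01; rewrite /f clamp01_id.
have K0 := L1_norm_ge0 _ _ u0L; have EM := expR_mass_bounds _ _ u0L.
have K1 : expR (- L1_norm u0) <= 1 <= expR (L1_norm u0).
  by rewrite expR_le1 oppr_le0 K0 -expR0 ler_expR.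
have Rd : 0 <= R0 / L <= 1 by rewrite divr_ge0 ?(ltW R00) ?(ltW L0)//= ler_pdivrMr// mul1r.
(* Sine coefficients of [f - q * (1 - y)], which is the initial datum minus e^M. *)
pose d n := fourier_sin f n - q * step_coef n.
have dB n : `|d n| <= 2 * expR (L1_norm u0) * (R0 / L).
  apply: fourier_sin_near_step => // y.
    move=> y01; rewrite fE// zi//.
    (* Both data lie in [exp (-||u0||_1), exp ||u0||_1], so their distance is below the upper
       end. *)
    have /andP[? ?] := w_init_bounds _ _ u0L (L * y); have := expR_gt0 (- L1_norm u0) => ?.
    by move/andP: EM => [? ?]; rewrite ler_norml /q; apply/andP; split; lra.
  move=> /andP[dy y1]; have y0 : 0 <= y by apply: le_trans (ltW dy); case/andP: Rd.
  rewrite fE ?y0// zi ?y0// /w_init (mass_itv R0 _ R00 u0L) /q; last first.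
    by move: dy; rewrite ltr_pdivrMr// mulrC => /ltW.
  ring.
exists d; split=> // y y01; rewrite (mulrC c) -[w _ _]/(z y c); split.
  have /andP[//] : expR (- L1_norm u0) <= z y c <= expR (L1_norm u0).
  apply: (heat_sol_range _ _ _ hz) => //; last exact: ltW.
    by move=> t t0; have [-> ->] := zb t t0; rewrite /q subrKC.
  by move=> x x01; rewrite (zi x x01); exact: (w_init_bounds _ _ u0L (L * x)).
have hD := heat_sol_lin 1 (-1) _ _ hz (heat_sol_affine 1 q).
have := heat_sol_series c _ f y c0 cf f0 hD.
rewrite /= => /(_ _ _ y01) H.
have {}H : 1 * z y c + -1 * (1 + q * y) = heat_series c 0 (fourier_sin f) y.
  apply: H => [t t0|x x01].
    by have [-> ->] := zb t t0; split; ring.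
  by rewrite fE// mul1r mulN1r.
have [A fA] := fourier_sin_bounded _ cf.
have -> : d = (fun n => 1 * fourier_sin f n + (- q) * step_coef n).
  by apply/funext => n; rewrite mul1r mulNr.
rewrite (heat_series_lin c A 1)//; last exact: norm_step_coef.
by rewrite -H /step_profile; ring.
Qed.

(** On [0, L] [w] coincides with a function differentiable on the whole line, so the relative
    derivative exists at the end points too. *)
Lemma hopf_cole_series {R : realType} (c L q : R) (w : R -> R -> R) (d : nat -> R)
    (A t : R) :
  0 < c -> 0 < L -> (forall n, `|d n| <= A) ->
  (forall y : R, 0 <= y <= 1 -> w (L * y) t = step_profile c q y + heat_series c 0 d y) ->
  forall y : R, 0 <= y <= 1 -> hopf_cole L w (L * y) t =
    L^-1 * ((dstep_profile c q y + heat_series c 1 d y) /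
            (step_profile c q y + heat_series c 0 d y)).
Proof.
move=> c0 L0 dA hw y y01; rewrite /hopf_cole hw// mulrA; congr (_ / _).
have xL : `[0, L]%classic (L * y).
  by move: y01 => /andP[y0 y1]; rewrite /= in_itv/= mulr_ge0 ?(ltW L0)//= ger_pMr.
pose W y := step_profile c q y + heat_series c 0 d y.
have dW : is_derive y 1 W (dstep_profile c q y + heat_series c 1 d y).
  exact: is_deriveD (is_derive_step_profile _ _ _ c0) (is_derive_heat_series _ _ _ _ _ c0 dA).
have LK : L^-1 * (L * y) = y by rewrite mulKf// gt_eqF.
have dWL : is_derive (L * y) 1 (fun x => W (L^-1 * x))
    ((dstep_profile c q y + heat_series c 1 d y) * L^-1).
  apply: is_derive1_comp; last exact: is_derive_lin.
  by rewrite LK.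
rewrite [RHS]mulrC.
apply: (diffq_derive_in (A := `[0, L]%classic) _ xL _).2; first by move=> x; exact: within_itv_dnbhs_proper.
apply: eq_diffq xL _ (is_derive_diffq _ _ _ _ dWL) => x /=; rewrite in_itv/= => /andP[x0 x1].
rewrite -{2}(mulVKf (lt0r_neq0 L0) x) hw// mulr_ge0 ?invr_ge0 ?(ltW L0)//=.
by rewrite mulrC ler_pdivrMr// mul1r.
Qed.

Lemma PhiE {R : realType} (M c xi : R) : 0 < c ->
  Phi M c xi = Num.sqrt c * (dstep_profile c (expR M - 1) (xi * Num.sqrt c) /
    step_profile c (expR M - 1) (xi * Num.sqrt c)).
Proof.
move=> c0; have phiE y : phi y c = y + heat_series c 0 step_coef y by exact: phi_heat_series.
rewrite /Phi /dstep_profile /step_profile phiE.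
congr (_ * (_ * _ / _)).
have -> : phi ^~ c = (fun y => y + heat_series c 0 step_coef y) by apply/funext.
have d1 := is_derive_heat_series c 1 0 step_coef (xi * Num.sqrt c) c0 norm_step_coef.
by have [_ <-] := is_deriveD (is_derive_id (xi * Num.sqrt c) 1) d1; rewrite derive1E.
Qed.

(** * Lower bound for the profile and uniform jet estimates *)

(** With [phi] in [0, 1], the profile is a convex combination of 1 and e^M. *)
Lemma step_profile_ge {R : realType} (c m M y : R) : 0 < c -> 0 <= y <= 1 ->
  m <= 1 -> m <= expR M -> m <= step_profile c (expR M - 1) y.
Proof.
move=> c0 y01 m1 mM; have /andP[p0 p1] := phi_range c y c0 y01.
rewrite /step_profile; set p := y + _ in p0 p1 *; nra.
Qed.

(** Linear in [A], with [C] independent of [a]: coefficients of size O(1 / L) give jets of size O(1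
    / L). *)
Lemma jet_bounded_heat_series {R : realType} (D : set R) (c s : R) (k j : nat) : 0 < c ->
  exists2 C, 0 <= C & forall (a : nat -> R) (A : R), (forall n, `|a n| <= A) ->
    jet_bounded D k (fun xi => heat_series c j a (xi * s)) (A * C).
Proof.
move=> c0.
have dT (a : nat -> R) (A : R) (i : nat) (x : R) : (forall n, `|a n| <= A) ->
    is_derive x 1 (fun xi => heat_series c i a (xi * s)) (s * heat_series c i.+1 a (x * s)).
  move=> aA; rewrite mulrC; apply: is_derive1_comp.
    exact: (is_derive_heat_series c A i a (x * s) c0 aA).
  have -> : (fun x : R => x * s) = (fun x => s * x) by apply/funext => z; rewrite mulrC.
  exact: is_derive_lin.
have W0 i : 0 <= limn (series (@heat_weight R c i)).
  apply: limr_ge; first exact: cvg_heat_weight.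
  by apply: nearW => n; apply: sumr_ge0 => ? _; exact: heat_weight_ge0.
elim: k j => [|k IH] j.
  exists (limn (series (heat_weight c j))) => // a A aA; split.
    by move=> x _; have [] := heat_series_bound c A j a (x * s) c0 aA.
  apply: continuous_subspaceT => x; apply/differentiable_continuous/derivable1_diffP.
  by case: (dT a A j x aA).
have [C C0 HC] := IH j.+1.
exists (Num.max (limn (series (heat_weight c j))) (2 ^+ k * (`|s| * C))).
  by rewrite le_max W0.
move=> a A aA; have A0 : 0 <= A by exact: le_trans (aA 0%N).
split.
  move=> x _; have [_] := heat_series_bound c A j a (x * s) c0 aA.
  by move/le_trans; apply; rewrite ler_wpM2l// le_max lexx.
exists (fun xi => s * heat_series c j.+1 a (xi * s)).
  by move=> x _; exact: (is_derive_diffq D _ x _ (dT a A j x aA)).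
apply: jet_bounded_le (jet_boundedM (jet_bounded_cst _ k s) (HC a A aA)).
rewrite (_ : _ * (_ * _) = A * (2 ^+ k * (`|s| * C))); last by ring.
by rewrite ler_wpM2l// le_max lexx orbT.
Qed.

Lemma jet_bounded_scale {R : realType} (D : set R) (k : nat) (s B : R) :
  (forall x, D x -> `|x| <= B) ->
  exists C, jet_bounded D k (fun xi => xi * s) C.
Proof.
move=> DB; exists (Num.max (B * `|s|) `|s|).
have bB x : D x -> `|x * s| <= Num.max (B * `|s|) `|s|.
  by move=> /DB xB; rewrite normrM le_max ler_wpM2r.
have E : (fun x : R => x * s) = (fun x => s * x) by apply/funext => z; rewrite mulrC.
case: k => [|k]; split=> //.
  by rewrite E; apply: continuous_subspaceT; exact: continuous_lin.
exists (fun=> s).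
  by move=> x _; rewrite E; apply: is_derive_diffq; exact: is_derive_lin.
by apply: jet_bounded_le (jet_bounded_cst _ k s); rewrite le_max lexx orbT.
Qed.

(** The crude bound [e0] on [e] serves to bound the denominators uniformly; the difference of the
    quotients stays linear in [e]. *)
Lemma log_derivative_jets {R : realType} (D : set R) (B c s Q e0 m : R) (k : nat) :
  0 < c -> 0 < m -> (forall x, D x -> `|x| <= B) ->
  exists C, forall (q e : R) (d : nat -> R), `|q| <= Q -> e <= e0 ->
    (forall n, `|d n| <= e) ->
    let P xi := step_profile c q (xi * s) in
    let P' xi := dstep_profile c q (xi * s) in
    let T xi := heat_series c 0 d (xi * s) in
    let T' xi := heat_series c 1 d (xi * s) in
    (forall x, D x -> m <= P x) -> (forall x, D x -> m <= P x + T x) ->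
    [/\ exists C', jet_bounded D k (fun x => s * ((P' x + T' x) / (P x + T x))) C',
        exists C', jet_bounded D k (fun x => s * (P' x / P x)) C' &
        jet_bounded D k (fun x => s * ((P' x + T' x) / (P x + T x)) - s * (P' x / P x))
          (e * C)].
Proof.
move=> c0 m0 DB.
have [C0 C00 H0] := jet_bounded_heat_series D c s k 0 c0.
have [C1 C10 H1] := jet_bounded_heat_series D c s k 1 c0.
have [Cs Hs] := jet_bounded_scale D k s B DB.
pose BP := `|1 : R| + 2 ^+ k * (Q * (Cs + 1 * C0)).
pose BP' := 2 ^+ k * (Q * (`|1 : R| + 1 * C1)).
have [CV HV] := jet_boundedV D k (BP + `|e0| * C0) m0.
(* The bound that the sum and product rules yield for the difference when [T] and [T'] have jets
   bounded by [l * C0] and [l * C1]. It is homogeneous in [l], so [e * X 1 = X e]. *)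
pose X l := 2 ^+ k * (`|s| * (2 ^+ k * ((2 ^+ k * ((l * C1) * BP) +
  2 ^+ k * ((2 ^+ k * (`|-1 : R| * (l * C0))) * BP')) * (2 ^+ k * (CV * CV))))).
exists (X 1) => q e d qQ ee dd P P' T T' mP mPT.
have e_ge0 : 0 <= e by exact: le_trans (dd 0%N).
have jq : jet_bounded D k (fun=> q) Q by exact: jet_bounded_le qQ (jet_bounded_cst _ k q).
have j1 := jet_bounded_cst D k (1 : R).
have jP : jet_bounded D k P BP.
  exact: jet_boundedD j1 (jet_boundedM jq (jet_boundedD Hs (H0 _ _ norm_step_coef))).
have jP' : jet_bounded D k P' BP'.
  exact: jet_boundedM jq (jet_boundedD j1 (H1 _ _ norm_step_coef)).
have jT : jet_bounded D k T (e * C0) by exact: H0.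
have jT' : jet_bounded D k T' (e * C1) by exact: H1.
have e0C : e * C0 <= `|e0| * C0.
  by rewrite ler_wpM2r// (le_trans ee)// ler_norm.
have iPT : jet_bounded D k (fun x => (P x + T x)^-1) CV.
  apply: HV => //; apply: jet_bounded_le (jet_boundedD jP jT).
  by rewrite lerD2l.
have iP : jet_bounded D k (fun x => (P x)^-1) CV.
  by apply: HV => //; apply: jet_bounded_le jP; rewrite lerDl mulr_ge0.
have js := jet_bounded_cst D k s.
split.
- by eexists; exact: jet_boundedM js (jet_boundedM (jet_boundedD jP' jT') iPT).
- by eexists; exact: jet_boundedM js (jet_boundedM jP' iP).
have -> : e * X 1 = X e by rewrite /X; ring.
have := jet_boundedM js (jet_boundedM (jet_boundedD (jet_boundedM jT' jP)
  (jet_boundedM (jet_boundedM (jet_bounded_cst D k (-1 : R)) jT) jP')) (jet_boundedM iPT iP)).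
apply: eq_jet_bounded => x Dx.
(* (P' + T') / (P + T) - P' / P = (T' P - T P') / ((P + T) P) *)
have P0 : P x != 0 by rewrite gt_eqF// (lt_le_trans m0)// mP.
have PT0 : P x + T x != 0 by rewrite gt_eqF// (lt_le_trans m0)// mPT.
by field; apply/andP.
Qed.

Lemma Ck_norm_ge0 {R : realType} (A : set R) (k : nat) (f : R -> R) (x : R) :
  A x -> (0 <= Ck_norm A k f)%E.
Proof.
move=> Ax; apply: sume_ge0 => j _.
apply: (@le_trans _ _ `|derive_in_n A j f x|%:E); first by rewrite lee_fin.
by apply: ereal_sup_ubound; exists x.
Qed.

(** The [is_Ck] clauses give the norm its meaning, since the [lim] in [derive_in] has a default
    value where no derivative exists. *)
Theorem theorem3p3 (R : realType) (R0 c : R) (k : nat) :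
  0 < R0 -> 0 < c ->
  (forall r K : R, 0 < r -> r < (Num.sqrt c)^-1 ->
     exists C : R, forall u0 : R -> R,
       L1_supported R0 u0 -> L1_norm u0 = K ->
       forall (L : R) (w : R -> R -> R),
         R0 <= L -> hopf_cole_potential u0 L w ->
         let vL := rescale (hopf_cole L w) ^~ (c * L ^+ 2) in
         [/\ is_Ck `[0, r] k vL,
             is_Ck `[0, r] k (Phi (mass u0) c) &
             (Ck_norm `[0%R, r] k (vL \- Phi (mass u0) c)%R
                <= (C / L)%:E)%E]) /\
  (forall (u0 : R -> R) (w : R -> R -> R -> R),
     L1_supported R0 u0 ->
     (forall L : R, R0 <= L -> hopf_cole_potential u0 L (w L)) ->
     Ck_loc_cvg (Num.sqrt c)^-1 k
       (fun L => rescale (hopf_cole L (w L)) ^~ (c * L ^+ 2))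
       (Phi (mass u0) c)).
Proof.
move=> R00 c0; pose s := Num.sqrt c; have s0 : 0 < s by rewrite sqrtr_gt0.
have part1 (r K : R) : 0 < r -> r < s^-1 -> exists C : R, forall u0 : R -> R,
    L1_supported R0 u0 -> L1_norm u0 = K ->
    forall (L : R) (w : R -> R -> R), R0 <= L -> hopf_cole_potential u0 L w ->
    let vL := rescale (hopf_cole L w) ^~ (c * L ^+ 2) in
    [/\ is_Ck `[0, r] k vL, is_Ck `[0, r] k (Phi (mass u0) c) &
        (Ck_norm `[0%R, r] k (vL \- Phi (mass u0) c)%R <= (C / L)%:E)%E].
  move=> r0 rs; pose D : set R := [set` `[0, r]].
  have DE x : D x -> 0 <= x <= r by rewrite /D /= in_itv.
  have D_proper x : D x -> ProperFilter (within D x^') by exact: within_itv_dnbhs_proper.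
  have DB x : D x -> `|x| <= r by move=> /DE /andP[x0 xr]; rewrite ger0_norm.
  (* Bounds in terms of [K]: |q| <= exp K + 1, coefficient error at most 2 exp K because [R0 <= L],
     denominators at least exp (-K). *)
  have [C HC] := log_derivative_jets D r c s (expR K + 1) (2 * expR K) (expR (- K)) k
    c0 (expR_gt0 _) DB.
  exists (k.+1%:R * (2 * expR K * R0 * C)) => u0 u0L KE L w R0L hw vL.
  have L0 : 0 < L := lt_le_trans R00 R0L.
  have [d []] := hopf_cole_potential_series R0 c L u0 w R00 c0 R0L u0L hw.
  rewrite KE => dB wE; have wser y y01 := (wE y y01).2.
  set q := expR (mass u0) - 1 in wE wser.
  have D01 x : D x -> 0 <= x * s <= 1.
    move=> /DE /andP[x0 xr]; rewrite mulr_ge0 ?(ltW s0)//= -ler_pdivlMr// mul1r.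
    exact: le_trans xr (ltW rs).
  have K0 : 0 <= K by rewrite -KE; exact: L1_norm_ge0 u0L.
  have /andP[M1 M2] : expR (- K) <= expR (mass u0) <= expR K.
    by rewrite -KE; exact: expR_mass_bounds u0L.
  have vE x : D x -> vL x = s * ((dstep_profile c q (x * s) + heat_series c 1 d (x * s)) /
      (step_profile c q (x * s) + heat_series c 0 d (x * s))).
    (* The square root of [c * L ^+ 2] is [s * L], whose [L] cancels the [L^-1] of the chain
       rule. *)
    move=> /D01 xs; rewrite /vL /rescale sqrtrM ?(ltW c0)// sqrtr_sqr gtr0_norm// -/s.
    have -> : x * (s * L) = L * (x * s) by ring.
    rewrite (hopf_cole_series c L q w d _ _ c0 L0 dB wser)// mulrA mulfK//.
    by rewrite gt_eqF.
  have PE x : D x -> Phi (mass u0) c x =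
      s * (dstep_profile c q (x * s) / step_profile c q (x * s)).
    by move=> _; rewrite PhiE.
  have [||||[C1 J1] [C2 J2] J3] := HC q (2 * expR K * (R0 / L)) d _ _ dB.
  - have := expR_gt0 (- K); rewrite /q ler_norml => ?; apply/andP; split; lra.
  - have E0 : 0 <= 2 * expR K by apply: mulr_ge0 => //; exact: expR_ge0.
    by apply: ler_piMr => //; rewrite ler_pdivrMr// mul1r.
  - move=> x /D01 xs; apply: step_profile_ge => //.
    by rewrite expR_le1 oppr_le0.
  - by move=> x /D01 xs; have [h] := wE _ xs; rewrite -wser.
  split.
  - apply: (jet_bounded_derive D_proper _).1; apply: eq_jet_bounded J1 => x Dx.
    by rewrite vE.
  - apply: (jet_bounded_derive D_proper _).1; apply: eq_jet_bounded J2 => x Dx.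
    by rewrite PE.
  - have J : jet_bounded D k (vL \- Phi (mass u0) c) (2 * expR K * (R0 / L) * C).
      by apply: eq_jet_bounded J3 => x Dx /=; rewrite vE// PE.
    apply: le_trans (Ck_norm_le D_proper J) _; rewrite lee_fin le_eqVlt; apply/orP; left.
    by apply/eqP; ring.
split=> [r K r0 rs|u0 w u0L hw r r0 rs]; first exact: part1.
(* One [C] serves all [L], as it depends on [u0] only through its norm. *)
have [C HC] := part1 r (L1_norm u0) r0 rs.
apply: (@squeeze_cvge _ _ _ _ (cst 0%E) _ (fun L : R => (C / L)%:E)).
- near=> L; have RL : R0 <= L by near: L; apply: nbhs_pinfty_ge; exact: num_real.
  have [_ _ ->] := HC u0 u0L erefl L (w L) RL (hw L RL); rewrite andbT.
  by apply: (@Ck_norm_ge0 _ _ _ _ 0); rewrite /= in_itv/= lexx ltW.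
- exact: cvg_cst.
- apply: cvg_EFin; first exact: nearW.
  have : (fun L : R => C * L^-1) @ +oo --> C * 0.
    apply: cvgMr; apply/gtr0_cvgV0; last exact: cvg_id.
    by apply: nbhs_pinfty_gt; exact: num_real.
  by rewrite mulr0.
Unshelve. all: by end_near. Qed.
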